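(* For all $w\in S_n$, $$\mathrm{raj}(w)=\max\{\mathrm{maj}(v): v\le_R w\}=\max\{\mathrm{maj}(u^{-1}): u\le_L w\}=\deg\mathfrak{CM}_w(\mathbf x),$$ where $\le_L$ and $\le_R$ denote the left and right weak orders, respectively.
   Context: Permutations $w\in S_n$ are written in one-line notation $w(1)\cdots w(n)$; $ws_i$ is $w$ with the entries in positions $i,i+1$ switched, $s_i=(i\ i+1)$. $\mathrm{inv}(w)$ is the number of pairs $i<j$ with $w(i)>w(j)$. If $w=uv$ with $\mathrm{inv}(w)=\mathrm{inv}(u)+\mathrm{inv}(v)$, then $v\le_L w$ and $u\le_R w$; this defines the left and right weak orders. $w_0=n(n-1)\cdots1$. The major index $\mathrm{maj}(w)$ is the sum of the descents of $w$, i.e. of those $j\in[n-1]$ with $w(j)>w(j+1)$. Rajchgot index: for each $k$, take an increasing subsequence of $w(k)\cdots w(n)$ that contains $w(k)$ and has greatest length among such; $r_k$ is the number of terms of $w(k)\cdots w(n)$ omitted from it. $\mathrm{raj}(w)=r_1+\cdots+r_n$. Grothendieck polynomials: on $\mathbb Z[x_1,\dots,x_n]$ let $s_i$ act by exchanging $x_i$ and $x_{i+1}$, $\partial_i(f)=\frac{f-s_i\cdot f}{x_i-x_{i+1}}$, $\overline{\partial}_i(f)=\partial_i((1-x_{i+1})f)$. The $\mathfrak G_w(\mathbf x)$ are determined by $\mathfrak G_{w_0}(\mathbf x)=\prod_{i=1}^n x_i^{n-i}$ and $\overline{\partial}_i\mathfrak G_w(\mathbf x)=\mathfrak G_{ws_i}(\mathbf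 x)$ whenever $\mathrm{inv}(ws_i)<\mathrm{inv}(w)$. $\mathfrak{CM}_w(\mathbf x)$ is the highest-degree homogeneous part of $(-1)^{\deg\mathfrak G_w(\mathbf x)-\mathrm{inv}(w)}\mathfrak G_w(\mathbf x)$. *)

(* Defs.v *)
From HB Require Import structures.
From mathcomp Require Import all_boot all_order all_algebra all_fingroup.
From mathcomp Require Import mpoly.
From mathcomp Require Import zify ring.

Set Implicit Arguments.
Unset Strict Implicit.
Unset Printing Implicit Defensive.

Import GRing.Theory.

Local Open Scope ring_scope.

(* Positions, values and variables are numbered from 0: the k of 'I_n is the
   k + 1 of [n]. *)

(* The MathComp product of permutations acts on the left factor first; pcomp
   is the composition of functions, (uv)(k) = u(v(k)). *)
Definition pcomp n (u v : 'S_n) : 'S_n := (v * u)%g.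

(* For j = i + 1, w s_i. *)
Definition pswap n (w : 'S_n) (i j : 'I_n) : 'S_n := pcomp w (tperm i j).

Definition num_inv n (w : 'S_n) : nat :=
  #|[set p : 'I_n * 'I_n | (p.1 < p.2)%N && (w p.2 < w p.1)%N]|.

Definition leR n (u w : 'S_n) : bool :=
  [exists v : 'S_n, (w == pcomp u v) && (num_inv w == (num_inv u + num_inv v)%N)].

Definition leL n (v w : 'S_n) : bool :=
  [exists u : 'S_n, (w == pcomp u v) && (num_inv w == (num_inv u + num_inv v)%N)].

Definition longest n : 'S_n := perm (@rev_ord_inj n).

(* A descent at the positions i, i + 1 of 'I_n contributes its 1-based
   position i + 1. *)
Definition maj n (w : 'S_n) : nat :=
  (\sum_(i < n) \sum_(j < n | (j == i.+1 :> nat) && (w j < w i)) i.+1)%N.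

(* Subsequences are given by their sets of positions. *)
Definition increasing_from n (w : 'S_n) (k : 'I_n) (S : {set 'I_n}) : bool :=
  [&& k \in S, [forall i in S, (k <= i)%N]
    & [forall i in S, forall j in S, (i < j)%N ==> (w i < w j)%N]].

Definition raj_at n (w : 'S_n) (k : 'I_n) : nat :=
  (#|[set j : 'I_n | k <= j]|
   - \max_(S : {set 'I_n} | increasing_from w k S) #|S|)%N.

Definition raj n (w : 'S_n) : nat := (\sum_(k < n) raj_at w k)%N.

Section DividedDifference.
Variable n : nat.
Implicit Types (i j k : 'I_n) (f g : {mpoly int[n]}).

Lemma msymXU (s : 'S_n) i : msym s ('X_i : {mpoly int[n]}) = 'X_(s i).
Proof. by rewrite /msym mmapX mmap1U. Qed.

Lemma ddiff_ex i j f :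
  exists q : {mpoly int[n]}, f - msym (tperm i j) f == ('X_i - 'X_j) * q.
Proof.
pose D (g : {mpoly int[n]}) :=
  exists q : {mpoly int[n]}, g - msym (tperm i j) g = ('X_i - 'X_j) * q.
suff [q E] : D f by exists q; apply/eqP.
have DM g h : D g -> D h -> D (g * h).
  move=> [q Eq] [r Er]; exists (q * h + msym (tperm i j) g * r).
  rewrite msymM mulrDr mulrA -Eq mulrCA -Er; ring.
have D1 : D 1 by exists 0; rewrite msym1 subrr mulr0.
have DX k : D 'X_k.
  rewrite /D msymXU; case: tpermP => [->|->|_ _]; first by exists 1; rewrite mulr1.
    by exists (-1); rewrite mulrN1 opprB.
  by exists 0; rewrite subrr mulr0.
elim/mpolyind: f => [|c m p _ _ [q Eq]]; first by exists 0; rewrite msym0 subrr mulr0.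
have [r Er] : D 'X_[m].
  rewrite mpolyXE_id; elim/big_ind: _ => // k _.
  by elim: (m k) => [|e IH]; rewrite ?expr0 // exprS; apply: DM.
exists (c *: r + q); rewrite msymD msymZ mulrDr -scalerAr -Er -Eq scalerBr.
ring.
Qed.

(* The quotient (f - s_i f) / (x_i - x_{i+1}), for j = i + 1. *)
Definition ddiff i j f : {mpoly int[n]} := xchoose (ddiff_ex i j f).

Lemma ddiffP i j f :
  ('X_i - 'X_j) * ddiff i j f = f - msym (tperm i j) f.
Proof. by rewrite /ddiff -(eqP (xchooseP (ddiff_ex i j f))). Qed.

(* The operator written as the barred partial_i, for j = i + 1. *)
Definition bar_ddiff i j f : {mpoly int[n]} :=
  ddiff i j ((1 - 'X_j) * f).

Lemma bar_ddiffP i j f :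
  ('X_i - 'X_j) * bar_ddiff i j f =
  (1 - 'X_j) * f - (1 - 'X_i) * msym (tperm i j) f.
Proof. by rewrite ddiffP msymM msymB msym1 msymXU tpermR. Qed.

Lemma mpolyXB_neq0 i j : i != j -> ('X_i - 'X_j : {mpoly int[n]}) != 0.
Proof.
move=> ne; apply/eqP => /(congr1 (mcoeff U_(i))).
by rewrite mcoeffB mcoeff0 !mcoeffXU eqxx eq_sym (negPf ne).
Qed.

End DividedDifference.

Section Braid.

Lemma braid_field (F : fieldType) (a b c f A B AB BA W
    P PA PB PAB Q QB QA QBA QP AQP PQ BPQ PQP QPQ : F) :
  a - b != 0 -> b - c != 0 -> a - c != 0 ->
  (a - b) * P = (1 - b) * f - (1 - a) * A ->
  (b - a) * PA = (1 - a) * A - (1 - b) * f ->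
  (a - c) * PB = (1 - c) * B - (1 - a) * BA ->
  (b - c) * PAB = (1 - c) * AB - (1 - b) * W ->
  (b - c) * Q = (1 - c) * f - (1 - b) * B ->
  (c - b) * QB = (1 - b) * B - (1 - c) * f ->
  (a - c) * QA = (1 - c) * A - (1 - a) * AB ->
  (a - b) * QBA = (1 - b) * BA - (1 - a) * W ->
  (b - c) * QP = (1 - c) * P - (1 - b) * PB ->
  (a - c) * AQP = (1 - c) * PA - (1 - a) * PAB ->
  (a - b) * PQP = (1 - b) * QP - (1 - a) * AQP ->
  (a - b) * PQ = (1 - b) * Q - (1 - a) * QA ->
  (a - c) * BPQ = (1 - c) * QB - (1 - a) * QBA ->
  (b - c) * QPQ = (1 - c) * PQ - (1 - b) * BPQ ->
  PQP = QPQ.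
Proof.
move=> ab bc ac.
have ba : b - a != 0 by rewrite -opprB oppr_eq0.
have cb : c - b != 0 by rewrite -opprB oppr_eq0.
have sol x y z : x != 0 -> x * y = z -> y = z / x :> F.
  by move=> x0 <-; rewrite mulrAC mulfV // mul1r.
move=> /(sol _ _ _ ab) E1 /(sol _ _ _ ba) E2 /(sol _ _ _ ac) E3.
move=> /(sol _ _ _ bc) E4 /(sol _ _ _ bc) E5 /(sol _ _ _ cb) E6.
move=> /(sol _ _ _ ac) E7 /(sol _ _ _ ab) E8 /(sol _ _ _ bc) E9.
move=> /(sol _ _ _ ac) E10 /(sol _ _ _ ab) E11 /(sol _ _ _ ab) E12.
move=> /(sol _ _ _ ac) E13 /(sol _ _ _ bc) E14.
rewrite E11 E14 E9 E10 E12 E13 E1 E2 E3 E4 E5 E6 E7 E8.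
field.
by rewrite ab bc ac ba cb.
Qed.

Lemma commute_field (F : fieldType) (a b c d f A B W P PB Q QA QP PQ : F) :
  a - b != 0 -> c - d != 0 ->
  (a - b) * P = (1 - b) * f - (1 - a) * A ->
  (a - b) * PB = (1 - b) * B - (1 - a) * W ->
  (c - d) * Q = (1 - d) * f - (1 - c) * B ->
  (c - d) * QA = (1 - d) * A - (1 - c) * W ->
  (c - d) * QP = (1 - d) * P - (1 - c) * PB ->
  (a - b) * PQ = (1 - b) * Q - (1 - a) * QA ->
  QP = PQ.
Proof.
move=> ab cd.
have sol x y z : x != 0 -> x * y = z -> y = z / x :> F.
  by move=> x0 <-; rewrite mulrAC mulfV // mul1r.
move=> /(sol _ _ _ ab) E1 /(sol _ _ _ ab) E2 /(sol _ _ _ cd) E3.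
move=> /(sol _ _ _ cd) E4 /(sol _ _ _ cd) E5 /(sol _ _ _ ab) E6.
by rewrite E5 E6 E1 E2 E3 E4; field; rewrite ab cd.
Qed.

Variable n : nat.
Implicit Types (i j k l : 'I_n) (f : {mpoly int[n]}).

Let R := {mpoly int[n]}.

Lemma msym_bar_ddiff (t : 'S_n) i j f :
  ('X_(t i) - 'X_(t j)) * msym t (bar_ddiff i j f) =
  (1 - 'X_(t j)) * msym t f - (1 - 'X_(t i)) * msym t (msym (tperm i j) f).
Proof.
have := congr1 (msym t) (bar_ddiffP i j f).
by rewrite !(msymM, msymB, msym1, msymXU).
Qed.

Lemma lift_frac (a b y u z v w : R) :
  (a - b) * y = (1 - u) * z - (1 - v) * w ->
  let phi := @FracField.tofrac R in
  (phi a - phi b) * phi y = (1 - phi u) * phi z - (1 - phi v) * phi w.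
Proof. by move=> E phi; rewrite -[1](rmorph1 phi) -!rmorphB -!rmorphM E rmorphB. Qed.

Lemma bar_ddiff_braid i j k f : i != j -> j != k -> i != k ->
  bar_ddiff i j (bar_ddiff j k (bar_ddiff i j f)) =
  bar_ddiff j k (bar_ddiff i j (bar_ddiff j k f)).
Proof.
move=> ij jk ik.
have [ji kj ki] : [/\ j != i, k != j & k != i] by split; rewrite eq_sym.
have [[Xij Xjk] Xik] := (mpolyXB_neq0 ij, mpolyXB_neq0 jk, mpolyXB_neq0 ik).
pose s := tperm i j; pose t := tperm j k.
have [si sj sk] : [/\ s i = j, s j = i & s k = k].
  by rewrite /s tpermL tpermR tpermD.
have [ti tj tk] : [/\ t i = i, t j = k & t k = j].
  by rewrite /t tpermL tpermR tpermD // eq_sym.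
have br g : msym t (msym s (msym t g)) = msym s (msym t (msym s g)).
  rewrite -!msymMm; congr (msym _ g).
  have -> : (s * (t * s) = t ^ s)%g by rewrite conjgE tpermV.
  have -> : (t * (s * t) = s ^ t)%g by rewrite conjgE tpermV.
  by rewrite (tpermJ j k s) (tpermJ i j t) sj sk ti tj.
have sK g : msym s (msym s g) = g by rewrite -msymMm tperm2 msym1m.
have tK g : msym t (msym t g) = g by rewrite -msymMm tperm2 msym1m.
pose phi := @FracField.tofrac R.
have phi0 x : x != 0 -> phi x != 0 by rewrite tofrac_eq0.
apply/eqP; rewrite -tofrac_eq; apply/eqP; rewrite -/phi.
pose P := bar_ddiff i j; pose Q := bar_ddiff j k.
pose A (g : R) : R := msym s g; pose B (g : R) : R := msym t g.
have eP g := lift_frac (bar_ddiffP i j g).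
have eQ g := lift_frac (bar_ddiffP j k g).
have uP u g := lift_frac (msym_bar_ddiff u i j g).
have uQ u g := lift_frac (msym_bar_ddiff u j k g).
apply: (@braid_field {fraction R} (phi 'X_i) (phi 'X_j) (phi 'X_k) (phi f)
  (phi (A f)) (phi (B f)) (phi (A (B f))) (phi (B (A f))) (phi (A (B (A f))))
  (phi (P f)) (phi (A (P f))) (phi (B (P f))) (phi (A (B (P f))))
  (phi (Q f)) (phi (B (Q f))) (phi (A (Q f))) (phi (B (A (Q f))))
  (phi (Q (P f))) (phi (A (Q (P f))))
  (phi (P (Q f))) (phi (B (P (Q f)))) (phi (P (Q (P f)))) (phi (Q (P (Q f)))));
  try by rewrite -rmorphB phi0.
- exact: eP.
- by have := uP s f; rewrite si sj sK.
- by have := uP t f; rewrite ti tj.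
- by have := uP (t * s)%g f; rewrite !msymMm !permM ti tj si sk.
- exact: eQ.
- by have := uQ t f; rewrite tj tk tK.
- by have := uQ s f; rewrite sj sk.
- by have := uQ (s * t)%g f; rewrite !msymMm !permM sj sk ti tk br.
- exact: eQ.
- by have := uQ s (P f); rewrite sj sk.
- exact: eP.
- exact: eP.
- by have := uP t (Q f); rewrite ti tj.
- exact: eQ.
Qed.

Lemma bar_ddiff_commute i j k l f :
  i != j -> k != l -> i != k -> i != l -> j != k -> j != l ->
  bar_ddiff k l (bar_ddiff i j f) = bar_ddiff i j (bar_ddiff k l f).
Proof.
move=> ij kl ik il jk jl.
have [Xij Xkl] := (mpolyXB_neq0 ij, mpolyXB_neq0 kl).
pose s := tperm i j; pose t := tperm k l.
have [sk sl] : s k = k /\ s l = l by rewrite /s !tpermD.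
have [ti tj] : t i = i /\ t j = j by rewrite /t !tpermD // eq_sym.
have st g : msym t (msym s g) = msym s (msym t g).
  rewrite -!msymMm; congr (msym _ g).
  by apply/commgP/conjg_fixP; rewrite tpermJ -/t ti tj.
pose phi := @FracField.tofrac R.
have phi0 x : x != 0 -> phi x != 0 by rewrite tofrac_eq0.
apply/eqP; rewrite -tofrac_eq; apply/eqP; rewrite -/phi.
pose P := bar_ddiff i j; pose Q := bar_ddiff k l.
pose A (g : R) : R := msym s g; pose B (g : R) : R := msym t g.
have uP u g := lift_frac (msym_bar_ddiff u i j g).
have uQ u g := lift_frac (msym_bar_ddiff u k l g).
apply: (@commute_field _ (phi 'X_i) (phi 'X_j) (phi 'X_k) (phi 'X_l) (phi f)
  (phi (A f)) (phi (B f)) (phi (A (B f)))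
  (phi (P f)) (phi (B (P f))) (phi (Q f)) (phi (A (Q f)))
  (phi (Q (P f))) (phi (P (Q f)))); try by rewrite -rmorphB phi0.
- exact: (lift_frac (bar_ddiffP i j f)).
- by have := uP t f; rewrite ti tj st.
- exact: (lift_frac (bar_ddiffP k l f)).
- by have := uQ s f; rewrite sk sl.
- exact: (lift_frac (bar_ddiffP k l _)).
- exact: (lift_frac (bar_ddiffP i j _)).
Qed.
End Braid.

Section Grothendieck.
Variable n : nat.
Implicit Types (i j k l : 'I_n) (w u v : 'S_n).

Definition top_grothendieck : {mpoly int[n]} := \prod_(i < n) 'X_i ^+ (n - i.+1).

(* The conditions that determine the family of all G_w, w in S_n; there is
   exactly one such family (grothendieck_ex, grothendieck_uniq). *)
Definition is_grothendieck (G : {ffun 'S_n -> {mpoly int[n]}}) : bool :=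
  (G (longest n) == top_grothendieck) &&
  [forall w : 'S_n, forall i : 'I_n, forall j : 'I_n,
     (j == i.+1 :> nat) && (num_inv (pswap w i j) < num_inv w)%N ==>
       (bar_ddiff i j (G w) == G (pswap w i j))].

Lemma pswapL w i j : pswap w i j i = w j.
Proof. by rewrite /pswap /pcomp permM tpermL. Qed.

Lemma pswapR w i j : pswap w i j j = w i.
Proof. by rewrite /pswap /pcomp permM tpermR. Qed.

Lemma pswapD w i j k : i != k -> j != k -> pswap w i j k = w k.
Proof. by move=> ik jk; rewrite /pswap /pcomp permM tpermD. Qed.

Lemma pswapK w i j : pswap (pswap w i j) i j = w.
Proof. by apply/permP => k; rewrite !permM tpermK. Qed.

Lemma inv_asc w i j : j = i.+1 :> nat -> (w i < w j)%N ->
  num_inv (pswap w i j) = (num_inv w).+1.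
Proof.
move=> ij lt_w; pose s := tperm i j.
have ne : i != j by rewrite -val_eqE /=; lia.
pose S (u : 'S_n) := [set p : 'I_n * 'I_n | (p.1 < p.2)%N && (u p.2 < u p.1)%N].
pose h (p : 'I_n * 'I_n) := (s p.1, s p.2).
have hK : involutive h by case=> a b; rewrite /h /= !tpermK.
suff E : S (pswap w i j) = (i, j) |: h @: S w.
  rewrite /num_inv -/(S _) E cardsU1 card_imset; last exact: inv_inj.
  case: imsetP => // -[[a b]]; rewrite inE /= => /andP[ab _] [ea eb].
  by move: ab; rewrite -[a](tpermK i j) -[b](tpermK i j) -ea -eb tpermL tpermR; lia.
apply/setP=> -[a b]; rewrite in_setU1 inE /=.
have -> : ((a, b) \in h @: S w) = ((s a < s b) && (w (s b) < w (s a)))%N.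
  apply/imsetP/idP => [[[c d]]|H]; last by exists (s a, s b); rewrite ?inE // /h /= !tpermK.
  by rewrite inE /= => H [-> ->]; rewrite !tpermK.
rewrite /pswap /pcomp !permM xpair_eqE /s.
case: (tpermP i j a) => [->|->|/eqP + /eqP +];
  case: (tpermP i j b) => [->|->|/eqP + /eqP +];
  move: ne; rewrite -!val_eqE /=; lia.
Qed.

Lemma inv_pswap_lt w i j : j = i.+1 :> nat ->
  (num_inv (pswap w i j) < num_inv w)%N = (w j < w i)%N.
Proof.
move=> ij; have ne : w i != w j by rewrite (inj_eq perm_inj) -val_eqE /=; lia.
have [lt|le] := boolP (w i < w j)%N.
  by rewrite (inv_asc ij lt); lia.
have lt : (w j < w i)%N by move: ne; rewrite -val_eqE /=; lia.
have : num_inv w = (num_inv (pswap w i j)).+1.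
  by rewrite -{1}(pswapK w i j) (inv_asc ij) ?pswapL ?pswapR.
by move=> ->; rewrite lt ltnSn.
Qed.

Lemma pswap_braid w i j k : i != j -> j != k -> i != k ->
  pswap (pswap (pswap w i j) j k) i j = pswap (pswap (pswap w j k) i j) j k.
Proof.
move=> ij jk ik; unfold pswap, pcomp.
pose s := tperm i j; pose t := tperm j k; rewrite -/s -/t.
have E : (s * (t * s) = t * (s * t))%g.
  have -> : (s * (t * s) = t ^ s)%g by rewrite conjgE tpermV.
  have -> : (t * (s * t) = s ^ t)%g by rewrite conjgE tpermV.
  by rewrite !tpermJ tpermL tpermR (tpermD ik jk) tpermD // eq_sym.
by apply/permP => x; have := congr1 (fun p : 'S_n => w (p x)) E; rewrite !permM.
Qed.

Lemma pswap_commute w i j k l : i != k -> i != l -> j != k -> j != l ->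
  pswap (pswap w i j) k l = pswap (pswap w k l) i j.
Proof.
move=> ik il jk jl; unfold pswap, pcomp.
have E : (tperm k l * tperm i j = tperm i j * tperm k l)%g.
  by apply/commgP/conjg_fixP; rewrite tpermJ !tpermD // eq_sym.
by apply/permP => x; have := congr1 (fun p : 'S_n => w (p x)) E; rewrite !permM.
Qed.

(* The recurrence, for the w s_i with at least m inversions. *)
Definition step_above m (G : 'S_n -> {mpoly int[n]}) :=
  forall w i j, j = i.+1 :> nat -> (w j < w i)%N ->
    (m <= num_inv (pswap w i j))%N -> bar_ddiff i j (G w) = G (pswap w i j).

Lemma step_confluent m G u i j k l : step_above m G ->
  j = i.+1 :> nat -> l = k.+1 :> nat -> (u i < u j)%N -> (u k < u l)%N ->
  (m <= (num_inv u).+1)%N ->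
  bar_ddiff i j (G (pswap u i j)) = bar_ddiff k l (G (pswap u k l)).
Proof.
move=> HG; wlog ik : i j k l / (i <= k)%N => [H|].
  move=> ij kl ui uk mu; case: (leqP i k) => [|/ltnW] le; first exact: H.
  by rewrite (H k l i j).
move=> ij kl ui uk mu.
have step (v : 'S_n) (a b : 'I_n) : b = a.+1 :> nat -> (v a < v b)%N ->
    (m <= num_inv v)%N -> G v = bar_ddiff a b (G (pswap v a b)).
  by move=> ab va mv; rewrite HG ?pswapK ?pswapL ?pswapR.
have neq (a b : 'I_n) : (a < b)%N -> a != b by rewrite -val_eqE neq_ltn => ->.
have [{}ik|ik'] := eqVneq i k.
  have -> : l = j by apply: val_inj; rewrite /= kl ij ik.
  by rewrite ik.
have [jk|jk] := eqVneq j k.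
  subst k; have [nij njl nil] : [/\ i != j, j != l & i != l].
    by split; apply: neq; lia.
  have nji : j != i by rewrite eq_sym.
  have nlj : l != j by rewrite eq_sym.
  have nli : l != i by rewrite eq_sym.
  have H1 := inv_asc ij ui; have H2 := inv_asc kl uk.
  have E1 : G (pswap u i j) = bar_ddiff j l (G (pswap (pswap u i j) j l)).
    apply: step => //; last by rewrite H1; lia.
    by rewrite pswapR pswapD //; lia.
  have E2 : G (pswap (pswap u i j) j l) =
      bar_ddiff i j (G (pswap (pswap (pswap u i j) j l) i j)).
    apply: step => //; first by rewrite (pswapD _ nji nli) !pswapL pswapD.
    rewrite inv_asc // ?H1; first lia.
    by rewrite pswapR pswapD //; lia.
  have E3 : G (pswap u j l) = bar_ddiff i j (G (pswap (pswap u j l) i j)).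
    apply: step => //; last by rewrite H2; lia.
    by rewrite pswapL pswapD //; lia.
  have E4 : G (pswap (pswap u j l) i j) =
      bar_ddiff j l (G (pswap (pswap (pswap u j l) i j) j l)).
    apply: step => //; first by rewrite pswapR (pswapD _ nil njl) pswapR pswapD.
    rewrite inv_asc // ?H2; first lia.
    by rewrite pswapL pswapD //; lia.
  rewrite E1 E2 E3 E4 (pswap_braid u nij njl nil).
  exact: bar_ddiff_braid.
have [nij nkl] : i != j /\ k != l by split; apply: neq; lia.
have [nil njl] : i != l /\ j != l.
  by move: ik' jk; rewrite -!val_eqE /= => *; split; lia.
have E1 : G (pswap u i j) = bar_ddiff k l (G (pswap (pswap u i j) k l)).
  apply: step => //; last by rewrite (inv_asc ij ui); lia.
  by rewrite !pswapD.
have E2 : G (pswap u k l) = bar_ddiff i j (G (pswap (pswap u k l) i j)).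
  apply: step => //; last by rewrite (inv_asc kl uk); lia.
  by rewrite !pswapD // eq_sym.
rewrite E1 E2 (pswap_commute u ik' nil jk njl).
by apply/esym/bar_ddiff_commute.
Qed.

Lemma step_above_ex d : exists G : 'S_n -> {mpoly int[n]},
  G (longest n) = top_grothendieck /\ step_above ((n * n).+1 - d) G.
Proof.
elim: d => [|d [G [G0 HG]]].
  exists (fun=> top_grothendieck); split=> // w i j ij wji.
  rewrite subn0 => /leq_trans/(_ (max_card _)).
  by rewrite card_prod card_ord ltnn.
set m := (_ - d)%N in HG.
pose asc w := [pick p : 'I_n * 'I_n | (p.2 == p.1.+1 :> nat) && (w p.1 < w p.2)%N].
exists (fun w => if (m <= num_inv w)%N then G w else
  if asc w is Some p then bar_ddiff p.1 p.2 (G (pswap w p.1 p.2)) else G w).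
split.
  rewrite /asc; case: pickP => [[i j] /=|_]; last by rewrite if_same.
  case/andP=> /eqP ij; rewrite !permE /=; have := ltn_ord j; lia.
move=> w i j ij wji mle.
have wi : num_inv w = (num_inv (pswap w i j)).+1.
  by rewrite -{1}(pswapK w i j) inv_asc ?pswapL ?pswapR.
have -> : (m <= num_inv w)%N by move: mle; rewrite wi /m; lia.
case: ifP => [lem|_]; first exact: HG.
rewrite /asc; case: pickP => [[k l] /= /andP[/eqP kl ukl]|/(_ (i, j))]; last first.
  by rewrite /= ij eqxx pswapL pswapR wji.
rewrite -{1}(pswapK w i j); apply: (step_confluent HG) => //.
  by rewrite pswapL pswapR.
by move: mle; rewrite /m; lia.
Qed.

Lemma grothendieck_ex : exists G, is_grothendieck G.
Proof.
have [G [G0 HG]] := step_above_ex (n * n).+1.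
exists [ffun w => G w]; rewrite /is_grothendieck ffunE G0 eqxx /=.
apply/'forall_forallP => w i; apply/forallP => j; apply/implyP => /andP[/eqP ij].
by rewrite inv_pswap_lt // => wji; rewrite !ffunE HG // subnn.
Qed.

Lemma longest_max w :
  (forall i j, j = i.+1 :> nat -> ~~ (w i < w j)%N) -> w = longest n.
Proof.
move=> noasc.
have dec i j : (i < j)%N -> (w j + (j - i) <= w i)%N.
  move: {-1}(j - i)%N (erefl (j - i)%N) => d; elim: d j => [|d IH] j; first lia.
  move=> ji lt_ij; have lt' : (j.-1 < n)%N by have := ltn_ord j; lia.
  have := noasc (Ordinal lt') j; rewrite -leqNgt /= => /(_ ltac:(lia)).
  have ne : w j != w (Ordinal lt') by rewrite (inj_eq perm_inj) -val_eqE /=; lia.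
  move: ne; rewrite -val_eqE /= => ne le.
  have [e|e] := eqVneq i (Ordinal lt').
    by move: ne le; rewrite -e; move/(congr1 val): e => /=; lia.
  have := IH (Ordinal lt'); move: e; rewrite -val_eqE /=; lia.
apply/permP => i; apply: val_inj; rewrite permE /=.
have lt_i := ltn_ord i.
have n_gt0 : (0 < n)%N by lia.
have lt_n : (n.-1 < n)%N by lia.
have A : (w i + i <= n.-1)%N.
  have [e|e] := eqVneq i (Ordinal n_gt0).
    by have := ltn_ord (w i); move/(congr1 val): e => /= ->; lia.
  have := dec (Ordinal n_gt0) i; have := ltn_ord (w (Ordinal n_gt0)).
  by move: e; rewrite -val_eqE /=; lia.
have B : (n.-1 - i <= w i)%N.
  have [e|e] := eqVneq i (Ordinal lt_n).
    by move/(congr1 val): e => /= ->; lia.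
  by have := dec i (Ordinal lt_n); move: e; rewrite -val_eqE /=; lia.
lia.
Qed.

Lemma grothendieck_uniq G H : is_grothendieck G -> is_grothendieck H -> G = H.
Proof.
move=> /andP[/eqP G0 /'forall_forallP HG] /andP[/eqP H0 /'forall_forallP HH].
apply/ffunP => w; move: {2}(n * n - num_inv w)%N (leqnn (n * n - num_inv w)) => d.
elim: d w => [|d IH] w le_d; last first.
  case: (pickP (fun p : 'I_n * 'I_n =>
    (p.2 == p.1.+1 :> nat) && (w p.1 < w p.2)%N)) => [[i j] /andP[/= /eqP ij lt]|no].
    have E := inv_asc ij lt.
    have /forallP/(_ j)/implyP := HG (pswap w i j) i; rewrite pswapK.
    have /forallP/(_ j)/implyP := HH (pswap w i j) i; rewrite pswapK.
    rewrite ij eqxx E ltnS leqnn => /(_ isT)/eqP <- /(_ isT)/eqP <-.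
    by rewrite IH //; lia.
  rewrite (@longest_max w) ?G0 ?H0 // => i j ij; have := no (i, j).
  by rewrite /= ij eqxx /= => ->.
rewrite (@longest_max w) ?G0 ?H0 // => i j ij; apply/negP => lt.
have := max_card [set p : 'I_n * 'I_n |
  (p.1 < p.2)%N && (pswap w i j p.2 < pswap w i j p.1)%N].
by rewrite card_prod card_ord -/(num_inv _) (inv_asc ij lt); lia.
Qed.

End Grothendieck.

Definition grothendieck n (w : 'S_n) : {mpoly int[n]} :=
  xchoose (grothendieck_ex n) w.

Lemma grothendieck_longest n : grothendieck (longest n) = top_grothendieck n.
Proof. by have /andP[/eqP] := xchooseP (grothendieck_ex n). Qed.

Lemma grothendieck_step n (w : 'S_n) (i j : 'I_n) :
  j = i.+1 :> nat -> (num_inv (pswap w i j) < num_inv w)%N ->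
  bar_ddiff i j (grothendieck w) = grothendieck (pswap w i j).
Proof.
move=> ij lt; have /andP[_ /'forall_forallP/(_ w i)] := xchooseP (grothendieck_ex n).
by move=> /forallP/(_ j)/implyP; rewrite ij eqxx lt => /(_ isT)/eqP.
Qed.

Definition mpoly_deg n (p : {mpoly int[n]}) : nat := (msize p).-1.

Definition top_part n (p : {mpoly int[n]}) : {mpoly int[n]} :=
  pihomog mdeg (mpoly_deg p) p.

Definition castelnuovo_mumford n (w : 'S_n) : {mpoly int[n]} :=
  let G := grothendieck w in
  top_part ((-1 : int) ^ ((mpoly_deg G)%:Z - (num_inv w)%:Z) *: G).

(* Main.v *)
From Pilot Require Import Defs.
From mathcomp Require Import all_boot all_order all_algebra all_fingroup.
From mathcomp Require Import mpoly.
From mathcomp Require Import zify ring.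

Set Implicit Arguments.
Unset Strict Implicit.
Unset Printing Implicit Defensive.

Import Order.TTheory GRing.Theory Num.Theory.
(* Makes pcomp the composition of permutations again. *)
Import Pilot.Defs.

(** All the numbers in the theorem are computed from the lengths of longest
    chains.  Regard w as the set of points (p, w p), ordered by comparing both
    coordinates, and let lis w p be the length of a longest chain that starts at
    the position p.  Then raj w is a constant minus the sum of all lis w p
    (raj_lis), so raj w only depends on the poset; reflecting the points gives
    raj w^-1 = raj w (rajV), and removing relations from the poset increases raj.

    Weak order.  Going up in the right weak order removes relations, so raj is
    monotone (raj_leR).  A chain meets every decreasing run at most once, which
    gives maj v <= raj v (maj_le_raj).  Conversely, listing the values of w by
    levels of chain length, each level decreasingly, is a linear extension v of
    the poset, hence lies below w, and has maj v = raj w (exists_maj_ge_raj).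
    The left weak order is the right one read through inverses.

    Degree.  The Grothendieck polynomials are given by the Fomin-Kirillov
    product: the row of x_k is the product, over the letters a >= k, of
    1 + x_k u_a in the 0-Hecke algebra, and the coefficient of w in the product
    of the rows is the polynomial of w (grothendieck_rows).  That this product
    satisfies the recurrence follows from the commutation of two rows with the
    same letters (hecke_row_commute), a form of the Yang-Baxter equation.
    Expanding one row, the polynomial of w is a signed sum, over the subsets D of
    the letters of the row and the permutations v with Demazure product D * v
    equal to w, of x_k^|D| times the part of v in the later variables.  Two
    facts give the degree by induction on the rows:
    - |D| plus the contribution of v never exceeds that of w, because sorting
      makes chains longer, and a long chain of w among few blocks of used letters
      forces a corresponding growth of chain lengths in v (row_degree_le);
    - equality is attained when the blocks follow the levels of chain length
      (row_degree_ge), and the terms of top degree do not cancel, because the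
      sign of a coefficient is determined by its degree (signed_coef). *)

(** * Chains and the Rajchgot index *)

Section Chains.
Variable n : nat.
Implicit Types (u v w : 'S_n) (p q : 'I_n).

Definition lis w p : nat := \max_(S : {set 'I_n} | increasing_from w p S) #|S|.

Lemma increasing_from1 w p : increasing_from w p [set p].
Proof.
apply/and3P; split; first by rewrite inE.
  by apply/forall_inP => i; rewrite inE => /eqP ->.
apply/forall_inP => i; rewrite inE => /eqP ->.
by apply/forall_inP => j; rewrite inE => /eqP ->; rewrite ltnn.
Qed.

Lemma lis_gt0 w p : 0 < lis w p.
Proof.
by rewrite -(cards1 p); apply: (leq_bigmax_cond _ (increasing_from1 w p)).
Qed.

Lemma lis_witness w p : exists2 S, increasing_from w p S & #|S| = lis w p.
Proof.
have [|S S_inc E] := @eq_bigmax_cond _ (mem (increasing_from w p)) (fun S => #|S|).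
  by apply/card_gt0P; exists [set p]; apply: increasing_from1.
by exists S; rewrite // -E.
Qed.

Lemma lis_step w p q : p < q -> w p < w q -> lis w q < lis w p.
Proof.
move=> pq wpq; have [S /and3P[qS /forall_inP leS /forall_inP incS] <-] := lis_witness w q.
have pS : p \notin S by apply/negP => /leS; rewrite leqNgt pq.
have -> : #|S|.+1 = #|p |: S| by rewrite cardsU1 pS.
apply: leq_bigmax_cond; apply/and3P; split; first by rewrite setU11.
  apply/forall_inP => i /setU1P[->//|/leS]; exact/leq_trans/ltnW.
have lt_w j : j \in S -> w p < w j.
  move=> jS; have [->//|ne] := eqVneq j q.
  apply: (ltn_trans wpq); have /forall_inP/(_ j jS)/implyP := incS q qS; apply.
  by have := leS j jS; move: ne; rewrite -val_eqE /=; lia.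
apply/forall_inP => i /setU1P[->|iS]; apply/forall_inP => j /setU1P[->|jS];
  apply/implyP; rewrite ?ltnn //.
- by move=> _; apply: lt_w.
- by move=> ip; have := leS i iS; lia.
- by have /forall_inP/(_ j jS)/implyP := incS i iS.
Qed.

(** The second element of a longest chain is the witness. *)
Lemma lis_cases w p :
  lis w p = 1 \/ exists q, [/\ p < q, w p < w q & lis w p = (lis w q).+1].
Proof.
have [S /and3P[pS /forall_inP leS /forall_inP incS] cS] := lis_witness w p.
have [S1|[r rS]] := set_0Vmem (S :\ p).
  by left; rewrite -cS (cardsD1 p) pS S1 cards0.
right; case: (arg_minnP (fun i : 'I_n => i : nat) rS) => q /setD1P[qp qS] qmin.
have pq : p < q by have := leS q qS; move: qp; rewrite -val_eqE /=; lia.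
have wpq : w p < w q by have /forall_inP/(_ q qS)/implyP/(_ pq) := incS p pS.
exists q; split=> //; apply/eqP; rewrite eqn_leq lis_step // andbT.
rewrite -cS (cardsD1 p) pS ltnS; apply: leq_bigmax_cond.
apply/and3P; split; first by rewrite !inE qp.
  by apply/forall_inP => i; apply: qmin.
apply/forall_inP => i /setD1P[_ iS]; apply/forall_inP => j /setD1P[_ jS].
by have /forall_inP/(_ j jS) := incS i iS.
Qed.

(** Longest chain lengths form the least positive function that drops strictly
    along the chain order; every comparison of chain lengths goes through this. *)
Lemma lis_least w (f : 'I_n -> nat) :
  (forall p, 0 < f p) -> (forall p q, p < q -> w p < w q -> f q < f p) ->
  forall p, lis w p <= f p.
Proof.
move=> f_gt0 f_step p.
move: {2}(lis w p) (leqnn (lis w p)) => l.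
elim: l p => [|l IH] p le_l; first exact: leq_trans le_l _.
case: (lis_cases w p) => [->//|[q [pq wpq lp]]].
by rewrite lp (leq_ltn_trans (IH q _) (f_step _ _ pq wpq)) // -ltnS -lp.
Qed.

Lemma card_ge p : #|[set j : 'I_n | p <= j]| = n - p.
Proof.
have -> : [set j : 'I_n | p <= j] = ~: [set j : 'I_n | j < p].
  by apply/setP => j; rewrite !inE -leqNgt.
rewrite cardsCs setCK card_ord; congr (_ - _).
rewrite -sum1dep_card -(big_ord_widen n (fun=> 1)) ?sum_nat_const ?card_ord ?muln1 //.
exact: ltnW.
Qed.

Lemma lis_le w p : lis w p <= n - p.
Proof.
by apply: (lis_least (f := fun q : 'I_n => n - q)) => [q|q r qr _];
  have := ltn_ord q; lia.
Qed.

Lemma raj_lis w : raj w + \sum_p lis w p = \sum_(p < n) (n - p).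
Proof.
rewrite /raj -big_split; apply: eq_bigr => p _.
by rewrite /raj_at card_ge /= subnK // lis_le.
Qed.

(** Indexed by values, because the right weak order compares permutations at the
    same values. *)
Definition lisv w (a : 'I_n) : nat := lis w (w^-1 a)%g.

Lemma sum_lisv w : \sum_a lisv w a = \sum_p lis w p.
Proof. by rewrite (reindex_inj (@perm_inj _ w)); apply: eq_bigr => p _; rewrite /lisv permK. Qed.

Lemma lisv_least w (f : 'I_n -> nat) :
  (forall a, 0 < f a) ->
  (forall a b : 'I_n, a < b -> (w^-1)%g a < (w^-1)%g b -> f b < f a) ->
  forall a, lisv w a <= f a.
Proof.
move=> f0 fS a; rewrite /lisv -{2}(permKV w a).
apply: (lis_least (f := fun p => f (w p))) => // p q pq wpq.
by apply: fS; rewrite ?permK.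
Qed.

Lemma lisv_gt0 w a : 0 < lisv w a.
Proof. exact: lis_gt0. Qed.

Lemma lisv_step w (a b : 'I_n) :
  a < b -> (w^-1)%g a < (w^-1)%g b -> lisv w b < lisv w a.
Proof. by move=> ab iab; apply: lis_step; rewrite ?permKV. Qed.

(** Chains of the points (p, w p) are chains of the reflected points. *)
Lemma lisvV w p : lisv w^-1%g p = lis w p.
Proof.
rewrite /lisv invgK; apply/eqP; rewrite eqn_leq; apply/andP; split.
  rewrite -{2}(permK w p); apply: (lis_least (f := lisv w)).
    exact: lisv_gt0.
  exact: lisv_step.
apply: (lis_least (f := fun p => lis w^-1%g (w p))) => [q|q r qr wqr].
  exact: lis_gt0.
by apply: lis_step; rewrite ?permK.
Qed.

Lemma rajV w : raj w^-1%g = raj w.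
Proof.
have := raj_lis w; rewrite -(raj_lis w^-1%g) -[in RHS]sum_lisv.
by rewrite (eq_bigr _ (fun p _ => lisvV w p)) => /addIn.
Qed.

End Chains.

(** * Weak order *)

Section WeakOrder.
Variable n : nat.
Implicit Types (u v w : 'S_n).

(** As pairs of values, which is how the right weak order sees inversions. *)
Definition inv_values w : {set 'I_n * 'I_n} :=
  [set p : 'I_n * 'I_n | (p.1 < p.2) && ((w^-1)%g p.2 < (w^-1)%g p.1)].

Lemma num_invV w : num_inv w^-1%g = num_inv w.
Proof.
pose h (p : 'I_n * 'I_n) := ((w^-1)%g p.2, (w^-1)%g p.1).
have h_inj : injective h by move=> [a b] [c d] [/perm_inj -> /perm_inj ->].
rewrite /num_inv -(card_imset _ h_inj); apply: eq_card => -[a b].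
apply/imsetP/idP => [[[c d]]|]; rewrite !inE /=.
  by move=> /andP[cd dc] [-> ->]; rewrite !permKV cd dc.
move=> /andP[ab ba]; exists (w b, w a); rewrite ?inE /= ?permK ?ba //.
by rewrite /h /= !permK.
Qed.

Lemma num_inv_values w : num_inv w = #|inv_values w|.
Proof. by rewrite -num_invV. Qed.

(** The right factor u of w = v u exchanges a pair of values exactly when v and w
    disagree on it. *)
Lemma num_inv_pcomp v u :
  num_inv u = #|inv_values v :\: inv_values (pcomp v u)|
            + #|inv_values (pcomp v u) :\: inv_values v|.
Proof.
set w := pcomp v u.
have wE a : (w^-1)%g a = (u^-1)%g ((v^-1)%g a) by rewrite /w /pcomp invMg permM.
pose h (p : 'I_n * 'I_n) :=
  if v p.1 < v p.2 then (v p.1, v p.2) else (v p.2, v p.1).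
have -> : num_inv u = #|inv_values u| by rewrite num_inv_values.
rewrite -[RHS]cardsUI.
have -> : (inv_values v :\: inv_values w) :&: (inv_values w :\: inv_values v) = set0.
  by apply/setP => p; rewrite in_setI !in_setD in_set0; do 2!case: (p \in _).
rewrite cards0 addn0 -(@card_in_imset _ _ h (inv_values u)); last first.
  move=> [a b] [c d]; rewrite !inE /= /h /= => /andP[ab _] /andP[cd _].
  by do 2![case: ifP => _]; case=> /perm_inj e1 /perm_inj e2; subst => //; move: ab cd; lia.
apply: eq_card => -[a b]; apply/imsetP/idP => [[[c d]]|].
  rewrite !inE /h /= => /andP[cd dc].
  have ne : v c != v d by rewrite (inj_eq perm_inj) -val_eqE /=; lia.
  move: ne; rewrite -val_eqE /=.
  by case: ifP => vcd ne [-> ->]; rewrite !wE !permK; lia.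
rewrite !inE /= !wE => H.
have ne1 : (v^-1)%g a != (v^-1)%g b.
  by rewrite (inj_eq perm_inj) -val_eqE /=; lia.
have ne2 : (u^-1)%g ((v^-1)%g a) != (u^-1)%g ((v^-1)%g b).
  by rewrite (inj_eq perm_inj).
move: ne1 ne2; rewrite -!val_eqE /= => ne1 ne2.
have [lt|ge] := ltnP ((v^-1)%g a) ((v^-1)%g b).
  exists ((v^-1)%g a, (v^-1)%g b); rewrite ?inE /h /= ?permKV; first lia.
  by case: ifP => //; lia.
exists ((v^-1)%g b, (v^-1)%g a); rewrite ?inE /h /= ?permKV; first lia.
by case: ifP => //; lia.
Qed.

(** The lengths add up exactly when the right factor undoes no inversion of v. *)
Lemma leRE v w : leR v w = (inv_values v \subset inv_values w).
Proof.
have key u : (num_inv (pcomp v u) == num_inv v + num_inv u) =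
    (inv_values v \subset inv_values (pcomp v u)).
  rewrite (num_inv_pcomp v u) !num_inv_values -setD_eq0 -cards_eq0.
  have := cardsID (inv_values (pcomp v u)) (inv_values v).
  have := cardsID (inv_values v) (inv_values (pcomp v u)).
  rewrite setIC; lia.
apply/existsP/idP => [[u /andP[/eqP -> ]]|sub]; first by rewrite key.
exists (w * v^-1)%g; have wE : w = pcomp v (w * v^-1)%g by rewrite /pcomp mulgKV.
by rewrite -wE eqxx; have := key (w * v^-1)%g; rewrite -wE sub => ->.
Qed.

Lemma leLE u w : leL u w = leR u^-1%g w^-1%g.
Proof.
apply/existsP/existsP => -[x /andP[/eqP wE /eqP iE]]; exists x^-1%g.
  rewrite !num_invV iE addnC eqxx andbT wE /pcomp invMg; exact: eqxx.
rewrite -num_invV iE !num_invV addnC eqxx andbT -(invgK w) wE /pcomp invMg invgK.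
exact: eqxx.
Qed.

(** Fewer inversions leave more chain relations. *)
Lemma raj_leR v w : leR v w -> raj v <= raj w.
Proof.
rewrite leRE => /subsetP sub.
suff : \sum_a lisv w a <= \sum_a lisv v a.
  by rewrite !sum_lisv; have := raj_lis v; have := raj_lis w; lia.
apply: leq_sum => a _; apply: lisv_least; first exact: lisv_gt0.
move=> {}a b ab iab; apply: lisv_step => //.
have ne : (v^-1)%g a != (v^-1)%g b by rewrite (inj_eq perm_inj) -val_eqE /=; lia.
have := sub (a, b); rewrite !inE /= ab /=; move: ne; rewrite -val_eqE /=; lia.
Qed.

End WeakOrder.

(** * Major index *)

Section MajorIndex.
Variable n : nat.
Implicit Types (u v w : 'S_n).

Definition descent v (i : 'I_n) : bool :=
  [exists j : 'I_n, (j == i.+1 :> nat) && (v j < v i)].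

(** Counts the maximal decreasing runs of the entries from position k on, by
    their last positions. *)
Definition runs_from v (k : 'I_n) : nat := \sum_(i < n | k <= i) ~~ descent v i.

Lemma descent_next v (i j : 'I_n) : j = i.+1 :> nat -> descent v i = (v j < v i).
Proof.
move=> ij; apply/existsP/idP => [[j' /andP[/eqP ij']]|lt]; last first.
  by exists j; rewrite ij eqxx.
by have -> : j' = j by apply: val_inj; rewrite /= ij ij'.
Qed.

Lemma descent_last v (i : 'I_n) : i.+1 = n -> descent v i = false.
Proof.
by move=> i_n; apply/existsP => -[j /andP[/eqP ij _]]; have := ltn_ord j; lia.
Qed.

Lemma runs_from_next v (k j : 'I_n) :
  j = k.+1 :> nat -> runs_from v k = ~~ (v j < v k) + runs_from v j.
Proof.
move=> kj; rewrite /runs_from (bigD1 k) //= (descent_next v kj); congr (_ + _).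
by apply: eq_bigl => i; rewrite -val_eqE /=; lia.
Qed.

Lemma runs_from_mono v (i j : 'I_n) : i <= j -> runs_from v j <= runs_from v i.
Proof.
move=> ij; rewrite /runs_from big_mkcond [leqRHS]big_mkcond /=.
by apply: leq_sum => k _; case: (leqP j k) => // /(leq_trans ij) ->.
Qed.

Lemma runs_from_gt0 v k : 0 < runs_from v k.
Proof.
have n_gt0 := ltn_ord k.
have lt_n : n.-1 < n by lia.
rewrite /runs_from (bigD1 (Ordinal lt_n)) /=; last by lia.
by rewrite descent_last //= prednK //; lia.
Qed.

(** Each position i that ends a descent contributes its index i + 1, which is
    the number of starting points k that see it. *)
Lemma maj_runs v : maj v + \sum_k runs_from v k = \sum_(k < n) (n - k).
Proof.
have -> : maj v = \sum_(k < n) \sum_(i < n | k <= i) descent v i.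
  rewrite (exchange_big_dep xpredT) //=; apply: eq_bigr => i _.
  have -> : \sum_(k < n | k <= i) (descent v i : nat) = i.+1 * descent v i.
    rewrite sum_nat_const; congr (_ * _).
    rewrite -sum1_card -(big_ord_widen n (fun=> 1) (ltn_ord i)).
    by rewrite sum_nat_const card_ord muln1.
  have [/existsP[j /andP[/eqP ij lt]]|/existsPn no] := boolP (descent v i).
    rewrite muln1 (big_pred1 j) // => j' /=; rewrite -val_eqE /= ij.
    apply/andP/eqP => [[/eqP -> _]//|e]; rewrite e eqxx.
    by have -> : j' = j by apply: val_inj; rewrite /= e ij.
  by rewrite muln0 big1 // => j; rewrite (negPf (no j)).
rewrite -big_split; apply: eq_bigr => k _ /=; rewrite -big_split /=.
rewrite -[RHS]card_ge -sum1_card; apply: eq_big => [i|i _]; first by rewrite inE.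
by case: descent.
Qed.

(** A chain meets each decreasing run at most once. *)
Lemma lis_le_runs v k : lis v k <= runs_from v k.
Proof.
apply: lis_least => {k} [k|k q kq vkq]; first exact: runs_from_gt0.
move e: (q - k) => d; elim: d k e kq vkq => [|d IH] k e kq vkq; first lia.
have lt_n : k.+1 < n by have := ltn_ord q; lia.
rewrite (runs_from_next v (k := k) (j := Ordinal lt_n)) //.
have [eq|ne] := eqVneq q (Ordinal lt_n).
  by rewrite -eq [v q < v k]ltnNge (ltnW vkq).
have lt : k.+1 < q by move: ne; rewrite -val_eqE /=; lia.
have [desc|/= asc] := ltnP (v (Ordinal lt_n)) (v k).
  by rewrite add0n IH //=; lia.
by rewrite add1n ltnS runs_from_mono // ltnW.
Qed.

Lemma maj_le_raj v : maj v <= raj v.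
Proof.
have : \sum_k lis v k <= \sum_k runs_from v k.
  by apply: leq_sum => k _; apply: lis_le_runs.
by have := maj_runs v; have := raj_lis v; lia.
Qed.

(** Listing the values by decreasing chain length, and decreasingly within a
    level, respects the chain order of w, so it gives a permutation below w;
    within a level every step is a descent, so the runs cannot outnumber the
    levels. *)
Lemma exists_maj_ge_raj w : exists2 v, leR v w & raj w <= maj v.
Proof.
pose before (a b : 'I_n) :=
  (lisv w b < lisv w a) || (lisv w b == lisv w a) && (b < a).
have beforeT a b c : before a b -> before b c -> before a c.
  by rewrite /before; lia.
have beforeN a b : a != b -> before a b || before b a.
  by rewrite /before -val_eqE /=; lia.
have before0 a : before a a = false by rewrite /before; lia.
have rank_lt a : #|[set b | before b a]| < n.
  rewrite -[X in _ < X]card_ord -cardsT; apply: proper_card.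
  rewrite properE subsetT; apply/negP => /subsetP/(_ a).
  by rewrite !inE before0 => /(_ isT).
pose rank a := Ordinal (rank_lt a).
have rank_homo a b : before a b -> rank a < rank b.
  move=> ab; apply: proper_card; rewrite properE; apply/andP; split.
    by apply/subsetP => c; rewrite !inE => /beforeT; apply.
  by apply/negP => /subsetP/(_ a); rewrite !inE before0 => /(_ ab).
have rank_inj : injective rank.
  move=> a b /(congr1 val) /= e; apply/eqP; apply: contraT => /beforeN.
  by case/orP => /rank_homo /=; rewrite e ltnn.
pose v : 'S_n := (perm rank_inj)^-1%g.
have v_before (i j : 'I_n) : i < j -> before (v i) (v j).
  have rankK (k : 'I_n) : rank (v k) = k by rewrite -[RHS](permKV (perm rank_inj)) permE.
  move=> ij; have ne : v i != v j by rewrite (inj_eq perm_inj) -val_eqE /=; lia.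
  case/orP: (beforeN _ _ ne) => // /rank_homo; rewrite !rankK; lia.
exists v.
  rewrite leRE; apply/subsetP => -[a b]; rewrite !inE invgK !(permE rank_inj).
  move=> /andP[/= ab ba]; rewrite ab /=; apply: contraLR ba; rewrite -!leqNgt => le.
  apply/ltnW/rank_homo; rewrite /before lisv_step //.
  have : (w^-1)%g a != (w^-1)%g b by rewrite (inj_eq perm_inj) -val_eqE /=; lia.
  by rewrite -val_eqE /=; lia.
suff : \sum_k runs_from v k <= \sum_k lis w k.
  by have := maj_runs v; have := raj_lis w; lia.
rewrite -sum_lisv [leqRHS](reindex_inj (@perm_inj _ v)); apply: leq_sum => k _.
move e: (n - k) => d; elim: d k e => [|d IH] k e; first by have := ltn_ord k; lia.
have [last|lt_n] := leqP n k.+1.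
  rewrite /runs_from (big_pred1 k) => [|i]; last first.
    by rewrite /= -val_eqE /=; have := ltn_ord i; have := ltn_ord k; lia.
  by apply: (leq_trans _ (lisv_gt0 _ _)); case: (~~ _).
have /= := IH (Ordinal lt_n); rewrite (runs_from_next v (k := k) (j := Ordinal lt_n)) //.
by have := v_before k (Ordinal lt_n) (leqnn _); rewrite /before; lia.
Qed.

Lemma max_maj_leR w : \max_(v : 'S_n | leR v w) maj v = raj w.
Proof.
apply/eqP; rewrite eqn_leq; apply/andP; split.
  by apply/bigmax_leqP => v vw; apply: leq_trans (maj_le_raj v) (raj_leR vw).
have [v vw le] := exists_maj_ge_raj w.
by apply: leq_trans le _; apply: leq_bigmax_cond.
Qed.

Lemma max_maj_leL w : \max_(u : 'S_n | leL u w) maj u^-1%g = raj w.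
Proof.
rewrite -rajV -max_maj_leR (reindex_inj invg_inj); apply: eq_big => [u|u _].
  by rewrite leLE invgK.
by rewrite invgK.
Qed.

End MajorIndex.

(** * Sorting adjacent positions and adjacent values *)

Section Sorting.
Variable n : nat.
Implicit Types (u v w : 'S_n) (i j k : 'I_n).

Definition sortR i j w : 'S_n := if w j < w i then pswap w i j else w.

Definition sortL i j w : 'S_n := (sortR i j w^-1)^-1%g.

Lemma sortLE i j w :
  sortL i j w = if (w^-1)%g j < (w^-1)%g i then (w * tperm i j)%g else w.
Proof.
rewrite /sortL /sortR; case: ifP => _; last by rewrite invgK.
by rewrite /pswap /pcomp invMg invgK tpermV.
Qed.

Lemma sortR_id i j w : sortR i j (sortR i j w) = sortR i j w.
Proof.
rewrite {2 3}/sortR; case: ifP => lt; last by rewrite /sortR lt.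
by rewrite /sortR pswapL pswapR; case: ifP => // lt'; move: lt lt'; lia.
Qed.

Lemma sortL_id i j w : sortL i j (sortL i j w) = sortL i j w.
Proof. by rewrite /sortL invgK sortR_id. Qed.

Lemma sortR_asc i j w : w i < w j -> sortR i j w = w.
Proof. by move=> lt; rewrite /sortR ltnNge ltnW. Qed.

Lemma sortR_desc i j w : w j < w i -> sortR i j w = pswap w i j.
Proof. by rewrite /sortR => ->. Qed.

(** Both sides arrange the three entries increasingly. *)
Lemma sortR_braid i j k w : i != j -> j != k -> i != k ->
  sortR i j (sortR j k (sortR i j w)) = sortR j k (sortR i j (sortR j k w)).
Proof.
move=> ij jk ik.
have [ji kj ki] : [/\ j != i, k != j & k != i] by split; rewrite eq_sym.
have [nij njk nik] : [/\ w i != w j, w j != w k & w i != w k].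
  by rewrite !(inj_eq perm_inj).
move: nij njk nik; rewrite -!val_eqE /= => nij njk nik.
have Dk u := pswapD u ik jk; have Di u := pswapD u ji ki.
have [ba|ab] := ltnP (w j) (w i); have [cb|bc] := ltnP (w k) (w j);
  have [ca|ac] := ltnP (w k) (w i); try (exfalso; lia);
  repeat match goal with |- context[sortR ?p ?q ?u] =>
    lazymatch u with
    | context[sortR _ _ _] => fail
    | _ => (rewrite (@sortR_asc p q u);
              last by rewrite ?(pswapL, pswapR, Dk, Di); lia)
        || (rewrite (@sortR_desc p q u);
              last by rewrite ?(pswapL, pswapR, Dk, Di); lia)
    end end; by rewrite ?pswap_braid.
Qed.

Lemma sortL_braid i j k w : i != j -> j != k -> i != k ->
  sortL i j (sortL j k (sortL i j w)) = sortL j k (sortL i j (sortL j k w)).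
Proof. by move=> ij jk ik; rewrite /sortL !invgK sortR_braid. Qed.

Lemma sortR_commute i j k l w : i != k -> i != l -> j != k -> j != l ->
  sortR i j (sortR k l w) = sortR k l (sortR i j w).
Proof.
move=> ik il jk jl.
have [ki li kj lj] : [/\ k != i, l != i, k != j & l != j] by split; rewrite eq_sym.
have e : (pswap w k l j < pswap w k l i) = (w j < w i) by rewrite !pswapD.
have e' : (pswap w i j l < pswap w i j k) = (w l < w k) by rewrite !pswapD.
rewrite /sortR; case c: (w j < w i); case c': (w l < w k);
  by rewrite ?e ?e' ?c ?c' // pswap_commute.
Qed.

Lemma sortL_commute i j k l w : i != k -> i != l -> j != k -> j != l ->
  sortL i j (sortL k l w) = sortL k l (sortL i j w).
Proof. by move=> ik il jk jl; rewrite /sortL !invgK sortR_commute. Qed.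

Lemma mul_tperm w i j : (w * tperm (w i) (w j))%g = pswap w i j.
Proof. by rewrite -tpermJ conjgE !mulgA mulgV mul1g. Qed.

Lemma tperm_adjacent_lt i j k l : j = i.+1 :> nat -> k != l ->
  ~~ ((k == i) && (l == j)) -> ~~ ((k == j) && (l == i)) ->
  (tperm i j k < tperm i j l) = (k < l).
Proof.
move=> ij; rewrite -!val_eqE /=.
by case: (tpermP i j k) => [->|->|/eqP + /eqP +];
  case: (tpermP i j l) => [->|->|/eqP + /eqP +]; rewrite -?val_eqE /=; lia.
Qed.

(** Sorting two adjacent positions and sorting two adjacent values commute: an
    exchange of adjacent values does not change the relative order of two
    entries, unless these entries are the two values, and then both sorting
    operations do the same. *)
Lemma sortLR i j (a b : 'I_n) w : j = i.+1 :> nat -> b = a.+1 :> nat ->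
  sortL a b (sortR i j w) = sortR i j (sortL a b w).
Proof.
move=> ij ab.
have nij : i != j by rewrite -val_eqE /= ij; lia.
have nab : a != b by rewrite -val_eqE /= ab; lia.
have wV x p : (w^-1)%g x = p -> w p = x by move=> <-; rewrite permKV.
have [/andP[/eqP wi /eqP wj]|no1] := boolP ((w i == a) && (w j == b)).
  have sR : sortR i j w = w by rewrite sortR_asc // wi wj; lia.
  have sL : sortL a b w = w by rewrite sortLE -wi -wj !permK; case: ifP => //; lia.
  by rewrite !(sR, sL).
have [/andP[/eqP wi /eqP wj]|no2] := boolP ((w i == b) && (w j == a)).
  have sR : sortR i j w = pswap w i j by rewrite sortR_desc // wi wj; lia.
  have sL : sortL a b w = pswap w i j.
    by rewrite sortLE -wi -wj !permK ij leqnn tpermC mul_tperm.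
  by rewrite sR sL -{1}sL sortL_id sL -sR sortR_id.
have cL : ((pswap w i j)^-1%g b < (pswap w i j)^-1%g a) = ((w^-1)%g b < (w^-1)%g a).
  rewrite /pswap /pcomp invMg tpermV !permM tperm_adjacent_lt //.
  - by rewrite (inj_eq perm_inj) eq_sym.
  - by apply: contra no2 => /andP[/eqP/wV -> /eqP/wV ->]; rewrite !eqxx.
  - by apply: contra no1 => /andP[/eqP/wV -> /eqP/wV ->]; rewrite !eqxx.
have cR : ((w * tperm a b)%g j < (w * tperm a b)%g i) = (w j < w i).
  rewrite !permM tperm_adjacent_lt //.
  - by rewrite (inj_eq perm_inj) eq_sym.
  - by apply: contra no2 => /andP[-> ->].
  - by apply: contra no1 => /andP[-> ->].
rewrite !sortLE /sortR; case c: (w j < w i); case c': ((w^-1)%g b < (w^-1)%g a);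
  rewrite ?cL ?cR ?c ?c' //.
by rewrite /pswap /pcomp mulgA.
Qed.

(** A transposition of adjacent positions and one of adjacent values act in the
    same way next to the identity. *)
Lemma sortRL_fixed i j w : i < j ->
  sortR i j w i = i -> sortR i j w j = j -> sortL i j w = sortR i j w.
Proof.
move=> ij; rewrite sortLE /sortR; case: ifP => lt.
  rewrite pswapL pswapR => wj wi.
  rewrite (canLR (permK w) (esym wi)) (canLR (permK w) (esym wj)) ij.
  by rewrite -mul_tperm wi wj tpermC.
move=> wi wj; rewrite (canLR (permK w) (esym wi)) (canLR (permK w) (esym wj)).
by case: ifP => //; move: ij; lia.
Qed.
End Sorting.

(** * 0-Hecke operators on functions of permutations *)

Section HeckeOperators.
Local Open Scope ring_scope.
Variables (n : nat) (R : comNzRingType).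
Implicit Types (w : 'S_n.+1) (x y : R) (F G : 'S_n.+1 -> R).

Definition sort_letter a w : 'S_n.+1 := sortL (inord a) (inord a.+1) w.

(** The 0-Hecke factor 1 + x u_a with u_a ^ 2 = - u_a, in its dual action on
    functions of permutations. *)
Definition hecke a x F w : R := (1 - x) * F w + x * F (sort_letter a w).

(** The ordered product of the factors of the letters k, ..., k + d - 1, the
    smallest letter being applied first. *)
Fixpoint hecke_row k d x F : 'S_n.+1 -> R :=
  if d is d'.+1 then hecke (k + d') x (hecke_row k d' x F) else F.

Definition pull (f : 'S_n.+1 -> 'S_n.+1) F w : R := F (f w).

Lemma eq_hecke a x F G : F =1 G -> hecke a x F =1 hecke a x G.
Proof. by move=> FG w; rewrite /hecke !FG. Qed.

Lemma eq_hecke_row k d x F G : F =1 G -> hecke_row k d x F =1 hecke_row k d x G.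
Proof. by move=> FG; elim: d => //= d IH; apply: eq_hecke. Qed.

Lemma hecke_rowS k d x F : hecke_row k d.+1 x F =1 hecke_row k.+1 d x (hecke k x F).
Proof.
elim: d => [|d IH] w /=; first by rewrite addn0.
by rewrite addSnnS; apply: eq_hecke => v; rewrite -IH.
Qed.

Lemma hecke_row_lin k d x c e F G :
  hecke_row k d x (fun w => c * F w + e * G w) =1
  (fun w => c * hecke_row k d x F w + e * hecke_row k d x G w).
Proof.
elim: d => //= d IH w; rewrite /hecke !IH; ring.
Qed.

Lemma hecke_row_pull k d x (f : 'S_n.+1 -> 'S_n.+1) F :
  (forall a w, (k <= a < k + d)%N -> sort_letter a (f w) = f (sort_letter a w)) ->
  hecke_row k d x (pull f F) =1 pull f (hecke_row k d x F).
Proof.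
elim: d => //= d IH fE w.
have {}IH := IH (fun a v H => fE a v ltac:(lia)).
by rewrite /hecke !IH /pull fE //; lia.
Qed.

Lemma inord_neq a b : (a <= n)%N -> (b <= n)%N -> a != b -> inord a != inord b :> 'I_n.+1.
Proof. by move=> an bn; rewrite -val_eqE /= !inordK. Qed.

Lemma sort_letter_id a w : sort_letter a (sort_letter a w) = sort_letter a w.
Proof. exact: sortL_id. Qed.

Lemma sort_letter_commute a b w : (a.+1 < b < n)%N ->
  sort_letter a (sort_letter b w) = sort_letter b (sort_letter a w).
Proof.
by move=> /andP[ab bn]; apply: sortL_commute; apply: inord_neq; lia.
Qed.

Lemma sort_letter_braid a w : (a.+1 < n)%N ->
  sort_letter a (sort_letter a.+1 (sort_letter a w)) =
  sort_letter a.+1 (sort_letter a (sort_letter a.+1 w)).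
Proof. by move=> an; apply: sortL_braid; apply: inord_neq; lia. Qed.

Lemma hecke_pullK a x F : hecke a x (pull (sort_letter a) F) =1 pull (sort_letter a) F.
Proof. by move=> w; rewrite /hecke /pull sort_letter_id; ring. Qed.

Lemma hecke_hecke_row_commute a k d x y F :
  (a.+1 < k)%N -> (k + d <= n)%N ->
  hecke a x (hecke_row k d y F) =1 hecke_row k d y (hecke a x F).
Proof.
move=> ak kd w; rewrite /hecke hecke_row_lin; congr (_ + _ * _).
rewrite -/(pull (sort_letter a) F) hecke_row_pull // => b v kb.
by rewrite -sort_letter_commute //; lia.
Qed.

Lemma yang_baxter_scalars x y (c c' p p' r r' c1 p1 r1 : R) :
  (1 - y) * c + y * c1 = (1 - x) * c' + x * c1 ->
  (1 - y) * p + y * p1 = (1 - x) * p' + x * p1 ->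
  (1 - y) * r + y * r1 = (1 - x) * r' + x * r1 ->
  let e u v a b d := (1 - v) * ((1 - u) * (1 - v) * a + (u + v - u * v) * b)
    + v * (1 - u) * (1 - v) * c1 + v ^+ 2 * (1 - u) * p1
    + u * v * (1 - v) * d + u * v ^+ 2 * r1 in
  e x y c p r = e y x c' p' r'.
Proof.
move=> Ec Ep Er e; have eE u v a b d : e u v a b d =
    (1 - u) * (1 - v) * ((1 - v) * a + v * c1)
    + (u + v - u * v) * ((1 - v) * b + v * p1)
    + u * v * ((1 - v) * d + v * r1) - u * v * p1 by rewrite /e; ring.
rewrite !eE Ec Ep Er; ring.
Qed.

(** Commutation of the rows with parameters x and y.  Write P and Q for the
    sorting of the letters k and k + 1, and C x y for the two rows with the
    factor of k removed from the first and those of k and k + 1 from the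
    second.  The induction hypothesis is the symmetry of C x y ((1 - y) + y Q);
    hence C x y Q is symmetric, and the Yang-Baxter expansion of the remaining
    factors of k and k + 1 is a combination of these two symmetric expressions,
    by the braid relation P Q P = Q P Q. *)
Lemma hecke_row_commute k d x y F : (k + d <= n)%N ->
  hecke_row k d x (hecke_row k d y F) =1 hecke_row k d y (hecke_row k d x F).
Proof.
elim: d k F => [|[|d] IH] k F kd w //.
  by rewrite /= /hecke !sort_letter_id; ring.
pose C u v G := hecke_row k.+1 d.+1 u (hecke_row k.+2 d v G).
have CE u v G t : C u v G t = hecke_row k.+2 d u (hecke k.+1 u (hecke_row k.+2 d v G)) t.
  by rewrite /C hecke_rowS.
have rowE u v : hecke_row k d.+2 u (hecke_row k d.+2 v F) w =
    C u v (hecke k u (hecke k.+1 v (hecke k v F))) w.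
  rewrite hecke_rowS; apply: eq_hecke_row => {}w.
  rewrite -(hecke_hecke_row_commute (k := k.+2)) //; last lia.
  apply: eq_hecke => {}w; rewrite hecke_rowS.
  by rewrite hecke_rowS.
have eqC u v G G' : G =1 G' -> C u v G =1 C u v G'.
  by move=> GG; apply: eq_hecke_row; apply: eq_hecke_row.
have linC u v c e G G' t : C u v (fun s => c * G s + e * G' s) t =
    c * C u v G t + e * C u v G' t.
  rewrite /C -hecke_row_lin; apply: eq_hecke_row; exact: hecke_row_lin.
pose P := pull (sort_letter k); pose Q := pull (sort_letter k.+1).
have symC G : (1 - y) * C x y G w + y * C x y (Q G) w =
    (1 - x) * C y x G w + x * C y x (Q G) w.
  have E u v : (1 - v) * C u v G w + v * C u v (Q G) w =
      hecke_row k.+1 d.+1 u (hecke_row k.+1 d.+1 v G) w.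
    by rewrite -linC; apply: eq_hecke_row => s; rewrite hecke_rowS.
  by rewrite !E IH //; lia.
have symCQ G : C x y (Q G) w = C y x (Q G) w.
  have QQ : Q (Q G) =1 Q G by move=> s; rewrite /Q /pull sort_letter_id.
  have := symC (Q G); rewrite !(eqC _ _ _ _ QQ).
  have -> (s t : R) : (1 - s) * t + s * t = t by ring.
  by have -> (s t : R) : (1 - s) * t + s * t = t by ring.
have expand u v : C u v (hecke k u (hecke k.+1 v (hecke k v F))) w =
    (1 - v) * ((1 - u) * (1 - v) * C u v F w + (u + v - u * v) * C u v (P F) w)
    + v * (1 - u) * (1 - v) * C u v (Q F) w + v ^+ 2 * (1 - u) * C u v (Q (P F)) w
    + u * v * (1 - v) * C u v (P (Q F)) w + u * v ^+ 2 * C u v (Q (P (Q F))) w.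
  have E : hecke k u (hecke k.+1 v (hecke k v F)) =1 (fun s =>
      1 * (((1 - v) * (1 - u) * (1 - v)) * F s + ((1 - v) * (u + v - u * v)) * P F s)
    + 1 * (1 * ((v * (1 - u) * (1 - v)) * Q F s + (v ^+ 2 * (1 - u)) * Q (P F) s)
    + 1 * ((u * v * (1 - v)) * P (Q F) s + (u * v ^+ 2) * Q (P (Q F)) s))).
    move=> s; rewrite /hecke /P /Q /pull -sort_letter_braid; last lia.
    by rewrite !sort_letter_id; ring.
  rewrite (eqC _ _ _ _ E) !linC; ring.
rewrite !rowE !expand -!symCQ.
by apply: yang_baxter_scalars; rewrite symC symCQ.
Qed.

End HeckeOperators.

Section Letters.
Local Open Scope ring_scope.
Variable n : nat.
Implicit Types (u v w : 'S_n.+1) (p q : 'I_n.+1).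

Definition left_descent a w : bool :=
  ((w^-1)%g (inord a.+1) < (w^-1)%g (inord a))%N.

Definition swap_letter a w : 'S_n.+1 := (w * tperm (inord a) (inord a.+1))%g.

Lemma sort_letterE a w :
  sort_letter a w = if left_descent a w then swap_letter a w else w.
Proof. exact: sortLE. Qed.

Lemma swap_letter_val a w p : (a < n)%N -> swap_letter a w p =
  (if w p == a :> nat then a.+1 else if w p == a.+1 :> nat then a else w p) :> nat.
Proof.
move=> an; have e : (inord a : 'I_n.+1) = a :> nat by rewrite inordK //; lia.
have e' : (inord a.+1 : 'I_n.+1) = a.+1 :> nat by rewrite inordK.
rewrite permM; case: tpermP => [->|->|/eqP n1 /eqP n2].
- by rewrite e e' eqxx.
- by rewrite e e' eqxx ifF //; lia.
- by move: n1 n2; rewrite -!val_eqE /= e e' => /negPf -> /negPf ->.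
Qed.

Lemma left_descentE a w p q : (a < n)%N ->
  w p = a.+1 :> nat -> w q = a :> nat -> left_descent a w = (p < q)%N.
Proof.
move=> an wp wq; rewrite /left_descent.
have -> : inord a.+1 = w p by apply: val_inj; rewrite /= inordK; lia.
have -> : inord a = w q by apply: val_inj; rewrite /= inordK; lia.
by rewrite !permK.
Qed.

Definition fixes_below k w : bool := [forall p : 'I_n.+1, (p < k)%N ==> (w p == p)].

Lemma fixes_belowP k w :
  reflect (forall p, (p < k)%N -> w p = p) (fixes_below k w).
Proof.
apply: (iffP forallP) => [H p pk|H p]; first by apply/eqP; apply: (implyP (H p)).
by apply/implyP => pk; rewrite H.
Qed.

Lemma fixes_below_sort k a w : (k <= a)%N -> (a < n)%N ->
  fixes_below k (sort_letter a w) = fixes_below k w.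
Proof.
move=> ka an; rewrite sort_letterE; case: ifP => // _.
apply/fixes_belowP/fixes_belowP => H p pk; have := congr1 val (H p pk) => /= E;
  apply: val_inj; move: E => /=; rewrite swap_letter_val //; repeat case: ifP; lia.
Qed.

Definition supported (R : comNzRingType) k (F : 'S_n.+1 -> R) : Prop :=
  forall w, ~~ fixes_below k w -> F w = 0.

Lemma supported_hecke_row (R : comNzRingType) k l d (x : R) F :
  (k <= l)%N -> (l + d <= n)%N -> supported k F -> supported k (hecke_row l d x F).
Proof.
move=> kl; elim: d => //= d IH ld sF w wk.
by rewrite /hecke !IH ?fixes_below_sort //; try lia; ring.
Qed.

Lemma supportedW (R : comNzRingType) k l (F : 'S_n.+1 -> R) :
  (k <= l)%N -> supported l F -> supported k F.
Proof.
move=> kl sF w wk; apply: sF; apply: contra wk => /fixes_belowP H.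
by apply/fixes_belowP => p pk; apply: H; lia.
Qed.

(** The letters up to k + d - 1 cannot bring a value above k + d down to k. *)
Lemma hecke_row_eq0 (R : comNzRingType) k d (x : R) F w :
  (k + d <= n)%N -> supported k.+1 F -> (k + d < w (inord k))%N ->
  hecke_row k d x F w = 0.
Proof.
elim: d w => [|d IH] w kd sF big /=.
  apply: sF; apply/fixes_belowP => /(_ (inord k)) H; move: big; rewrite H inordK; lia.
rewrite /hecke !IH //; try lia; first by ring.
rewrite sort_letterE; case: ifP => _; last lia.
by rewrite swap_letter_val; last lia; repeat case: ifP; lia.
Qed.

(** Started on the decreasing arrangement of the positions from k on, a row has a
    single term: if one letter does not sort the entry at position k down, this
    entry stays too large (hecke_row_eq0). *)
Lemma hecke_row_top (R : comNzRingType) k d (x : R) F u v :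
  (k + d <= n)%N -> supported k.+1 F ->
  (forall p, u p = (if p < k then p : nat else if p == k :> nat then k + d
     else if n - (p - k) < k + d then n - (p - k) else (n - (p - k)).+1)%N :> nat) ->
  (forall p, v p = (if p < k.+1 then p : nat else n - (p - k.+1))%N :> nat) ->
  hecke_row k d x F u = x ^+ d * F v.
Proof.
elim: d u => [|d IH] u kd sF uE vE /=.
  have -> : u = v; last by rewrite mul1r.
  apply/permP => p; apply: val_inj; rewrite /= uE vE.
  by have := ltn_ord p; repeat case: ifP; lia.
have kn : (k < n.+1)%N by lia.
have posk : u (inord k) = k + d.+1 :> nat by rewrite uE inordK // ltnn eqxx.
rewrite /hecke (@hecke_row_eq0 _ k d) //; try lia.
rewrite mulr0 add0r exprS -mulrA; congr (_ * _); apply: IH => //; first lia.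
have lt_n : (k + (n - (k + d)) < n.+1)%N by lia.
have posd : u (Ordinal lt_n) = k + d :> nat.
  by rewrite uE /=; repeat case: ifP; lia.
move=> p; rewrite sort_letterE (@left_descentE _ _ (inord k) (Ordinal lt_n)) //; try lia.
rewrite inordK //= ifT; last lia.
rewrite swap_letter_val ?uE; last lia.
by have := ltn_ord p; repeat case: ifP; lia.
Qed.

End Letters.

(** * The Fomin-Kirillov product *)

Section FominKirillov.
Local Open Scope ring_scope.
Variable n : nat.
Implicit Types (u v w : 'S_n.+1) (i j p q : 'I_n.+1).
Local Notation R := {mpoly int[n.+1]}.
Implicit Types F : 'S_n.+1 -> R.

(** The last d rows of the Fomin-Kirillov product: the row of the variable x_k
    has the letters k, ..., n - 1, for k = n + 1 - d, ..., n. *)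
Fixpoint last_rows d : 'S_n.+1 -> R :=
  if d is d'.+1 then hecke_row (n - d') d' 'X_(inord (n - d')) (last_rows d')
  else fun w => (w == 1%g)%:R.

Lemma last_rows_supported d : (d <= n.+1)%N -> supported (n.+1 - d) (last_rows d).
Proof.
elim: d => [|d IH] dn /=.
  move=> w; case: eqP => [->|//]; rewrite subn0; case/negP.
  by apply/fixes_belowP => p _; rewrite perm1.
rewrite subSS; apply: supported_hecke_row; try lia.
by apply: (supportedW _ (IH _)); lia.
Qed.

Lemma last_rows_top d w : (d <= n.+1)%N ->
  (forall p, w p = (if p < n.+1 - d then p : nat else n - (p - (n.+1 - d)))%N :> nat) ->
  last_rows d w = \prod_(p < n.+1 | (n.+1 - d <= p)%N) 'X_p ^+ (n - p).
Proof.
elim: d w => [|d IH] w dn wE.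
  rewrite big_pred0 /= => [|p]; last by have := ltn_ord p; lia.
  have -> : w = 1%g; last by rewrite eqxx.
  apply/permP => p; apply: val_inj; rewrite /= wE perm1.
  by have := ltn_ord p; repeat case: ifP; lia.
pose k := (n - d)%N.
pose f (p : 'I_n.+1) : 'I_n.+1 :=
  inord (if p < k.+1 then p : nat else n - (p - k.+1))%N.
have fE p : f p = (if p < k.+1 then p : nat else n - (p - k.+1))%N :> nat.
  by rewrite inordK //; have := ltn_ord p; case: ifP; lia.
have f_inj : injective f.
  move=> p q /(congr1 val) /=; rewrite !fE => E; apply: val_inj => /=.
  by have := ltn_ord p; have := ltn_ord q; move: E; repeat case: ifP; lia.
have sub : (n.+1 - d = k.+1)%N by rewrite /k; lia.
rewrite /= (@hecke_row_top _ _ _ _ _ _ _ (perm f_inj)) -/k; try by [lia | rewrite /k; lia].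
- rewrite IH; try lia; last by move=> p; rewrite permE fE sub.
  rewrite [RHS](bigD1 (inord k)) /=; last by rewrite inordK; lia.
  rewrite inordK; last lia.
  congr (_ ^+ _ * _); first by rewrite /k; lia.
  apply: eq_bigl => p; rewrite -val_eqE /= inordK; last lia.
  by rewrite /k; lia.
- by rewrite -sub; apply: last_rows_supported; lia.
- by move=> p; rewrite wE /k; have := ltn_ord p; repeat case: ifP; lia.
- by move=> p; rewrite permE fE.
Qed.

(** The equation bar_ddiff i j (F w) = F (sortR i j w), cleared of the division
    by x_i - x_j. *)
Definition equivariant i j F : Prop := forall w,
  ('X_i - 'X_j) * F (sortR i j w) = (1 - 'X_j) * F w - (1 - 'X_i) * msym (tperm i j) (F w).

Lemma msym_hecke_row (s : 'S_n.+1) k d x F w :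
  msym s (hecke_row k d x F w) = hecke_row k d (msym s x) (fun v => msym s (F v)) w.
Proof.
elim: d w => //= d IH w.
by rewrite /hecke msymD !msymM msymB msym1 !IH.
Qed.

Lemma sort_letterR a i j w : (a < n)%N -> j = i.+1 :> nat ->
  sort_letter a (sortR i j w) = sortR i j (sort_letter a w).
Proof. by move=> an ij; apply: sortLR => //; rewrite !inordK //; lia. Qed.

Lemma equivariant_hecke_row i j k d x F : j = i.+1 :> nat -> (k + d <= n)%N ->
  msym (tperm i j) x = x -> equivariant i j F -> equivariant i j (hecke_row k d x F).
Proof.
move=> ij + xE eF; elim: d => //= d IH kd w.
have {}IH := IH ltac:(lia).
rewrite /hecke sort_letterR //; last lia.
rewrite msymD !msymM msymB msym1 xE mulrDr.
rewrite mulrCA IH [X in _ + X]mulrCA IH; ring.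
Qed.

Lemma msym_last_rows d i j w : (i < j)%N -> (j <= n - d)%N -> (d <= n.+1)%N ->
  msym (tperm i j) (last_rows d w) = last_rows d w.
Proof.
move=> ij; elim: d w => [|d IH] w jd dn /=.
  by case: (w == 1%g); rewrite ?msym1 ?msym0.
rewrite msym_hecke_row msymXU tpermD; last first.
- by rewrite -val_eqE /= inordK; lia.
- by rewrite -val_eqE /= inordK; lia.
by apply: eq_hecke_row => v; rewrite IH //; lia.
Qed.

(** The factor of the letter i completes the rows of x_i and x_{i+1} to the two
    commuting rows of the product S, which is therefore symmetric in the two
    variables.  With f the remaining rows and P the sorting of the letter i,
    (1 - x_{i+1}) times the rows from i on is S f - x_{i+1} S (P f), and S (P f)
    is what the divided difference leaves. *)
Lemma last_rows_equivariant_base d i j :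
  (d < n)%N -> i = inord (n - d.+1) -> j = inord (n - d) ->
  equivariant i j (last_rows d.+2).
Proof.
move=> dn iE jE w.
have iv : i = (n - d.+1)%N :> nat by rewrite iE inordK; lia.
have jv : j = (n - d)%N :> nat by rewrite jE inordK; lia.
have ij : j = i.+1 :> nat by rewrite iv jv; lia.
pose f := last_rows d; pose k := (n - d.+1)%N.
have kS : (n - d = k.+1)%N by rewrite /k; lia.
have rowsE : last_rows d.+2 = hecke_row k d.+1 'X_i (hecke_row k.+1 d 'X_j f).
  by rewrite /= -/k -kS -iE -jE.
have sortE v : sort_letter k v = sortL i j v.
  by rewrite /sort_letter iE jE -/k -kS.
have fsup : supported k.+2 f.
  have -> : k.+2 = (n.+1 - d)%N by rewrite /k; lia.
  by apply: last_rows_supported; lia.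
have f_fixed v : fixes_below k.+2 v -> v i = i /\ v j = j.
  by move=> /fixes_belowP H; split; apply: H; rewrite ?iv ?jv /k; lia.
have fLR : pull (sortR i j) f =1 pull (sort_letter k) f.
  move=> v; rewrite /pull sortE.
  have ij' : (i < j)%N by rewrite ij.
  have [/f_fixed[fi fj]|no1] := boolP (fixes_below k.+2 (sortR i j v)).
    by rewrite sortRL_fixed.
  have [/f_fixed[fi fj]|no2] := boolP (fixes_below k.+2 (sortL i j v)).
    have VV : sortR i j v = (sortL i j v^-1)^-1%g by rewrite /sortL !invgK.
    rewrite VV sortRL_fixed //; rewrite -[sortR i j v^-1]invgK -/(sortL i j v);
      by apply: (canLR (permK _)).
  by rewrite !fsup.
pose S (x y : R) (G : 'S_n.+1 -> R) : 'S_n.+1 -> R :=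
  hecke_row k d.+1 x (hecke_row k d.+1 y G).
pose Pf : 'S_n.+1 -> R := pull (sort_letter k) f.
have fold (x y : R) : (1 - y) * hecke_row k d.+1 x (hecke_row k.+1 d y f) w =
    S x y f w - y * S x y Pf w.
  transitivity (S x y (fun v => 1 * f v + (- y) * Pf v) w); last first.
    rewrite /S (eq_hecke_row _ _ _ (hecke_row_lin _ _ _ _ _ _ _)) hecke_row_lin; ring.
  have E : hecke_row k d.+1 y (fun v => 1 * f v + (- y) * Pf v) =1
      (fun v => (1 - y) * hecke_row k.+1 d y f v + 0 * f v).
    move=> v; rewrite hecke_rowS mul0r addr0.
    transitivity (hecke_row k.+1 d y (fun t => (1 - y) * f t + 0 * f t) v).
      apply: eq_hecke_row => t; rewrite /hecke /Pf /pull sort_letter_id; ring.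
    by rewrite hecke_row_lin mul0r addr0.
  rewrite /S (eq_hecke_row _ _ _ E) hecke_row_lin; ring.
have Scomm x y G : S x y G w = S y x G w by apply: hecke_row_commute; rewrite /k; lia.
rewrite rowsE.
have -> : hecke_row k d.+1 'X_i (hecke_row k.+1 d 'X_j f) (sortR i j w) = S 'X_i 'X_j Pf w.
  rewrite -/(pull (sortR i j) _ w) -hecke_row_pull; last first.
    by move=> a v /andP[_ ak]; apply: sort_letterR => //; move: ak; rewrite /k; lia.
  apply: eq_hecke_row => v; rewrite -hecke_row_pull; last first.
    by move=> a t /andP[_ ak]; apply: sort_letterR => //; move: ak; rewrite /k; lia.
  rewrite (eq_hecke_row _ _ _ fLR) hecke_rowS.
  by apply: eq_hecke_row => t; rewrite hecke_pullK.
have fsym : (fun v => msym (tperm i j) (f v)) =1 f.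
  by move=> v; apply: msym_last_rows; rewrite ?ij ?iv; lia.
rewrite fold msym_hecke_row msymXU tpermL.
have -> : (1 - 'X_i) * hecke_row k d.+1 'X_j
    (fun v => msym (tperm i j) (hecke_row k.+1 d 'X_j f v)) w =
    S 'X_i 'X_j f w - 'X_i * S 'X_i 'X_j Pf w.
  rewrite ![S 'X_i _ _ _]Scomm -fold; congr (_ * _).
  apply: eq_hecke_row => v; rewrite msym_hecke_row msymXU tpermR.
  exact: eq_hecke_row.
ring.
Qed.

Lemma last_rows_equivariant i j : j = i.+1 :> nat ->
  equivariant i j (last_rows n.+1).
Proof.
move=> ij; have jn := ltn_ord j.
suff main d : (n - i.+1 <= d)%N -> (d < n)%N -> equivariant i j (last_rows d.+2).
  by have := main n.-1; rewrite prednK; [apply; lia | lia].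
elim: d => [|d IH] di dn.
  by apply: last_rows_equivariant_base => //; apply: val_inj; rewrite /= inordK; lia.
have [e|ne] := eqVneq (n - i.+1)%N d.+1.
  by apply: last_rows_equivariant_base => //; apply: val_inj; rewrite /= inordK; lia.
apply: equivariant_hecke_row => //; first lia; last by apply: IH; lia.
by rewrite msymXU tpermD // -val_eqE /= inordK; lia.
Qed.

Lemma grothendieck_rows w : grothendieck w = last_rows n.+1 w.
Proof.
suff E : is_grothendieck [ffun w => last_rows n.+1 w].
  by rewrite /grothendieck (grothendieck_uniq (xchooseP (grothendieck_ex _)) E) ffunE.
apply/andP; split.
  rewrite ffunE last_rows_top //; last first.
    by move=> p; rewrite permE /= subnn subn0 subSS.
  by apply/eqP; apply: eq_big => [p|p _]; rewrite ?subnn // subSS.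
apply/'forall_forallP => {}w i; apply/forallP => j; apply/implyP => /andP[/eqP ij].
rewrite inv_pswap_lt // !ffunE => lt.
have nij : i != j by rewrite -val_eqE /=; lia.
apply/eqP/(mulfI (mpolyXB_neq0 nij)).
by rewrite bar_ddiffP -(last_rows_equivariant ij) sortR_desc.
Qed.

End FominKirillov.

(** * Chain lengths under exchanges of adjacent values *)

Section ChainsUnderSwaps.
Variable n : nat.
Implicit Types (u v w : 'S_n.+1) (c p q r : 'I_n.+1).

Lemma num_inv_swap_letter a w : (a < n)%N -> left_descent a w ->
  num_inv w = (num_inv (swap_letter a w)).+1.
Proof.
move=> an desc; rewrite -num_invV -[in RHS]num_invV /swap_letter invMg tpermV.
set i := inord a; set j := inord a.+1.
have ij : j = i.+1 :> nat by rewrite /i /j !inordK //; lia.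
have := @inv_asc _ (pswap w^-1%g i j) i j ij.
by rewrite pswapK pswapL pswapR => ->.
Qed.

(** Putting two values in increasing order only adds a chain relation. *)
Lemma lis_swap_letter a u p : (a < n)%N -> left_descent a u ->
  lis u p <= lis (swap_letter a u) p.
Proof.
move=> an desc; apply: lis_least => {p} [p|p q pq upq]; first exact: lis_gt0.
apply: lis_step => //; rewrite !swap_letter_val //.
have : (u q == a.+1 :> nat) && (u p == a :> nat) -> q < p.
  by case/andP => /eqP uq /eqP up; rewrite -(left_descentE an uq up).
by repeat case: ifP; lia.
Qed.

(** The new relation of a swap joins two points whose chain lengths already
    decrease strictly. *)
Lemma lis_swap_letter_eq a u c q p : (a < n)%N -> u c = a.+1 :> nat -> u q = a :> nat ->
  c < q -> lis u q < lis u c -> lis (swap_letter a u) p = lis u p.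
Proof.
move=> an uc uq cq lt; apply/eqP; rewrite eqn_leq lis_swap_letter ?(left_descentE an uc uq) //.
rewrite andbT; apply: lis_least => {p} [p|p r pr]; first exact: lis_gt0.
have [/andP[/eqP-> /eqP->]//|no] := boolP ((p == c) && (r == q)).
have {no} no : ~~ ((u p == a.+1 :> nat) && (u r == a :> nat)).
  by rewrite -uc -uq !(inj_eq val_inj) !(inj_eq perm_inj).
rewrite !swap_letter_val // => H; apply: lis_step => //.
by move: H no; repeat case: ifP; lia.
Qed.

(** A swap cannot affect the chains that start to the right of it. *)
Lemma lis_swap_letter_right a u c p : (a < n)%N -> left_descent a u ->
  u c = a.+1 :> nat -> c < p -> lis (swap_letter a u) p = lis u p.
Proof.
move=> an desc uc cp; apply/eqP; rewrite eqn_leq lis_swap_letter // andbT.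
(* Points weakly left of c get values above every chain length. *)
pose f r := if c < r then lis u r else n.+1 + (n.+1 - r).
rewrite (_ : lis u p = f p); last by rewrite /f cp.
apply: lis_least => {p cp} [p|p r pr].
  by rewrite /f; case: ifP => _; rewrite ?lis_gt0.
rewrite !swap_letter_val // /f => lt.
have [cp|pc] := ltnP c p; last first.
  have := lis_le u r; have := ltn_ord r; case: ifP; lia.
rewrite (ltn_trans cp pr); apply: lis_step => //.
have up : u p != a.+1 :> nat.
  by rewrite -uc (inj_eq val_inj) (inj_eq perm_inj) -val_eqE /=; lia.
have ur : u r != a.+1 :> nat.
  by rewrite -uc (inj_eq val_inj) (inj_eq perm_inj) -val_eqE /=; lia.
by move: lt; rewrite (negPf up) (negPf ur); repeat case: ifP; lia.
Qed.


End ChainsUnderSwaps.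

(** * Signs of coefficients *)

Section Coefficients.
Variable n : nat.
Implicit Types (w : 'S_n.+1) (i : 'I_n.+1) (m : 'X_{1..n.+1}).
Local Notation R := {mpoly int[n.+1]}.
Implicit Types (p : R) (F : 'S_n.+1 -> R).

Local Open Scope ring_scope.

Lemma mcoeffXM i p m : ('X_i * p)@_(U_(i) + m) = p@_m.
Proof. by rewrite mulrC mcoeffMX. Qed.

Lemma mcoeffXM_neq0 i p m : ('X_i * p)@_m != 0 -> exists m', m = (U_(i) + m')%MM.
Proof.
rewrite -mcoeff_msupp mulrC (perm_mem (msuppMX _ _)) => /mapP[m' _ ->].
by exists m'.
Qed.

(** The coefficients of a Grothendieck polynomial alternate in sign with the
    degree; these are the coefficients with the expected sign removed. *)
Definition signed_coef F w m : int := (-1) ^+ (mdeg m + num_inv w) * (F w)@_m.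

Lemma hecke_asc a (x : R) F w : ~~ left_descent a w -> hecke a x F w = F w.
Proof. by move=> /negPf asc; rewrite /hecke sort_letterE asc; ring. Qed.

Lemma hecke_desc a (x : R) F w : left_descent a w ->
  hecke a x F w = F w - x * F w + x * F (swap_letter a w).
Proof. by move=> desc; rewrite /hecke sort_letterE desc; ring. Qed.

Lemma signed_coef_asc a (x : R) F w m : ~~ left_descent a w ->
  signed_coef (hecke a x F) w m = signed_coef F w m.
Proof. by move=> asc; rewrite /signed_coef hecke_asc. Qed.

Lemma signed_coef_desc0 a i F w m : left_descent a w ->
  (forall m', m <> (U_(i) + m')%MM) ->
  signed_coef (hecke a 'X_i F) w m = signed_coef F w m.
Proof.
move=> desc no; rewrite /signed_coef hecke_desc // mcoeffD mcoeffB.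
have z p : ('X_i * p)@_m = 0.
  by apply/eqP; apply: contraT => /mcoeffXM_neq0[m' /no].
by rewrite !z subr0 addr0.
Qed.

Lemma signed_coef_desc a i F w m : (a < n)%N -> left_descent a w ->
  signed_coef (hecke a 'X_i F) w (U_(i) + m) =
  signed_coef F w (U_(i) + m) + (signed_coef F w m + signed_coef F (swap_letter a w) m).
Proof.
move=> an desc; rewrite /signed_coef hecke_desc // mcoeffD mcoeffB !mcoeffXM.
rewrite mdegD mdeg1 (num_inv_swap_letter an desc) !addnS !addSn !exprS; ring.
Qed.

Lemma mnm_factor i m : (forall m', m <> (U_(i) + m')%MM) \/ exists m', m = (U_(i) + m')%MM.
Proof.
have [le|nle] := boolP (U_(i) <= m)%MM.
  by right; exists (m - U_(i))%MM; rewrite addmC submK.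
by left=> m' e; move: nle; rewrite e lem_addr.
Qed.

Lemma signed_coef_ge0_hecke a i F w m : (a < n)%N ->
  (forall v m, 0 <= signed_coef F v m) -> 0 <= signed_coef (hecke a 'X_i F) w m.
Proof.
move=> an F_ge0; have [desc|asc] := boolP (left_descent a w); last by rewrite signed_coef_asc.
have [no|[m' ->]] := mnm_factor i m; first by rewrite signed_coef_desc0.
by rewrite signed_coef_desc // !addr_ge0.
Qed.

Lemma signed_coef_ge0_row k d i F w m : (k + d <= n)%N ->
  (forall v m, 0 <= signed_coef F v m) -> 0 <= signed_coef (hecke_row k d 'X_i F) w m.
Proof.
move=> + F_ge0; elim: d w m => //= d IH w m kd.
by apply: signed_coef_ge0_hecke => [|v m']; [lia | apply: IH; lia].
Qed.

Lemma signed_coef_gt0_unused a i F w m : (a < n)%N ->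
  (forall v m, 0 <= signed_coef F v m) ->
  0 < signed_coef F w m -> 0 < signed_coef (hecke a 'X_i F) w m.
Proof.
move=> an F_ge0; have [desc|asc] := boolP (left_descent a w); last by rewrite signed_coef_asc.
have [no|[m' ->]] := mnm_factor i m; first by rewrite signed_coef_desc0.
by move=> gt0; rewrite signed_coef_desc // ltr_wpDr // addr_ge0.
Qed.

Lemma signed_coef_gt0_used a i F w m : (a < n)%N ->
  (forall v m, 0 <= signed_coef F v m) -> left_descent a w ->
  0 < signed_coef F w m \/ 0 < signed_coef F (swap_letter a w) m ->
  0 < signed_coef (hecke a 'X_i F) w (U_(i) + m).
Proof.
move=> an F_ge0 desc H; rewrite signed_coef_desc // ltr_wpDl //.
by case: H => gt0; [rewrite ltr_wpDr | rewrite ltr_wpDl].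
Qed.

Lemma signed_coef_neq0_hecke a i F w m : (a < n)%N ->
  signed_coef (hecke a 'X_i F) w m != 0 ->
  signed_coef F w m != 0 \/ left_descent a w /\ exists2 m', m = (U_(i) + m')%MM &
    signed_coef F w m' != 0 \/ signed_coef F (swap_letter a w) m' != 0.
Proof.
move=> an; have [desc|asc] := boolP (left_descent a w); last first.
  by rewrite signed_coef_asc //; left.
have [no|[m' ->]] := mnm_factor i m; first by rewrite signed_coef_desc0 //; left.
rewrite signed_coef_desc //.
have [->|nz] := eqVneq (signed_coef F w (U_(i) + m')) 0; last by left.
rewrite add0r => H; right; split=> //; exists m' => //.
have [z|nz] := eqVneq (signed_coef F w m') 0; last by left.
by right; move: H; rewrite z add0r.
Qed.

End Coefficients.

(** * Degree of a row: upper bound *)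

Section RowDegree.
Variable n : nat.
Implicit Types (u v w : 'S_n.+1) (c p q r i : 'I_n.+1) (m : 'X_{1..n.+1}).
Local Notation R := {mpoly int[n.+1]}.
Implicit Types (F : 'S_n.+1 -> R).

Lemma exists_position w a : a <= n -> exists q, w q = a :> nat.
Proof. by move=> an; exists (w^-1%g (inord a)); rewrite permKV inordK. Qed.

Lemma position_inj w p q : w p = w q :> nat -> p = q.
Proof. by move=> /val_inj/perm_inj. Qed.

Lemma sum_values_ge w a q (f : 'I_n.+1 -> nat) (P : pred 'I_n.+1) :
  w q = a :> nat -> P q ->
  \sum_(p | (a <= w p) && P p) f p = f q + \sum_(p | (a < w p) && P p) f p.
Proof.
move=> wq Pq; rewrite (bigD1 q) /= ?wq ?leqnn //; congr (_ + _).
apply: eq_bigl => p; have [->|ne] := eqVneq p q; first by rewrite wq ltnn andbF.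
have : w p != a :> nat by apply: contra ne => /eqP; rewrite -wq => /position_inj ->.
by case: (P p); lia.
Qed.

(** The row is expanded from its largest letter down.  The state is the current
    permutation u, the position c of the value k + d, and the number B of blocks
    into which the letters left out so far cut the values from k + d on.  The
    invariants bound chains of w among these values by B plus the total growth of
    chain lengths from w to u: all_le for every chain, right_le, with 1 to spare,
    for the chains to the right of c, and c_le for the chain of w at c, the growth
    at c itself not being counted.  When the letters are exhausted, c is the
    position k, and c_le is what the induction on the rows needs. *)
Lemma row_degree_le k i F :
  (forall u m, (signed_coef F u m != 0)%R -> fixes_below k.+1 u /\
     mdeg m + \sum_(p < n.+1 | k < p) lis u p <= \sum_(p < n.+1 | k < p) (n.+1 - p)) ->
  forall d u w c B, k + d <= n ->
  (forall p, minn (u p) (k + d) = minn (w p) (k + d)) ->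
  u c = k + d :> nat -> 0 < B ->
  (forall p, lis w p <= lis u p) ->
  (forall p, k + d <= w p -> lis w p + \sum_(r | k + d <= w r) lis w r <=
     B + \sum_(r | k + d <= w r) lis u r) ->
  (forall p, k + d <= w p -> c < p -> lis w p + \sum_(r | k + d <= w r) lis w r <
     B + \sum_(r | k + d <= w r) lis u r) ->
  \sum_(r | k + d <= w r) lis w r <= B + \sum_(r | (k + d <= w r) && (r != c)) lis u r ->
  forall m, (signed_coef (hecke_row k d 'X_i F) u m != 0)%R ->
  mdeg m + (n.+1 - (k + d)) + \sum_(p < n.+1 | k <= p) lis w p <=
  B + \sum_(p < n.+1 | k <= p) (n.+1 - p).
Proof.
move=> F_le; elim=> [|d IH] u w c B kd agree uc B_gt0 mono all_le right_le c_le m.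
  rewrite /= => /F_le [/fixes_belowP fix_u].
  have kn : k < n.+1 by lia.
  have c_k : c = k :> nat.
    have /(congr1 val) /= := fix_u (Ordinal kn) (leqnn _).
    rewrite -[RHS](addn0 k) -uc => /position_inj <-; by [].
  have ge_k p : (k + 0 <= w p) = (k <= p).
    have := agree p; rewrite addn0; have [lt|ge] := ltnP p k.
      by have := fix_u p (ltnW lt); move/(congr1 val) => /=; lia.
    have [lt|_] := ltnP (u p) k; last lia.
    have /(congr1 val) /= := fix_u (u p) (ltnW lt); move/position_inj.
    by move/(congr1 val) => /=; lia.
  have tail (f : 'I_n.+1 -> nat) : \sum_(p < n.+1 | (k <= p) && (p != c)) f p =
      \sum_(p < n.+1 | k < p) f p.
    by apply: eq_bigl => p; rewrite -val_eqE /= c_k; lia.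
  have s1 : \sum_(p | k + 0 <= w p) lis w p = \sum_(p < n.+1 | k <= p) lis w p.
    exact: eq_bigl.
  have s2 : \sum_(p | (k + 0 <= w p) && (p != c)) lis u p =
      \sum_(p < n.+1 | k < p) lis u p.
    by rewrite -tail; apply: eq_bigl => p; rewrite ge_k.
  rewrite [X in _ -> _ <= _ + X](bigD1 c) /= ?c_k // tail.
  move: c_le; rewrite s1 s2.
  by move: (bigop _ _ _) (bigop _ _ _) (bigop _ _ _); lia.
rewrite addnS in kd agree uc all_le right_le c_le *.
have [q wq] := exists_position w (ltnW kd).
have uq : u q = k + d :> nat by have := agree q; rewrite wq; lia.
have qc : q != c by apply/eqP => e; move: uc; rewrite -e uq; lia.
have sumE f : \sum_(r | k + d <= w r) f r = f q + \sum_(r | k + d < w r) f r.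
  have := @sum_values_ge w _ q f xpredT wq isT.
  by rewrite !(eq_bigl _ _ (fun r => andbT _)).
have sumEc f : \sum_(r | (k + d <= w r) && (r != c)) f r =
    f q + \sum_(r | (k + d < w r) && (r != c)) f r.
  exact: sum_values_ge.
have sumEq f : \sum_(r | (k + d <= w r) && (r != q)) f r = \sum_(r | k + d < w r) f r.
  apply: eq_bigl => r; have [->|ne] := eqVneq r q; first by rewrite wq ltnn andbF.
  rewrite andbT; have : w r != k + d :> nat; last by lia.
  by apply: contra ne => /eqP; rewrite -wq => /position_inj ->.
have ge_cases p : k + d <= w p -> p = q \/ k + d < w p.
  rewrite leq_eqVlt => /orP[/eqP|]; last by right.
  by rewrite -wq => /position_inj ->; left.
have agree' p : minn (u p) (k + d) = minn (w p) (k + d) by have := agree p; lia.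
have sum_le : \sum_(r | k + d < w r) lis w r <= \sum_(r | k + d < w r) lis u r.
  exact: leq_sum.
have mono_q := mono q.
have q_cases : lis w q = 1 \/ exists r, [/\ q < r, k + d < w r & lis w q = (lis w r).+1].
  case: (lis_cases w q) => [->|[r [qr wqr ->]]]; [by left | right; exists r].
  by rewrite -wq.
(* Leaving out the letter k + d starts a new block, with q as its position. *)
have unused m' : (signed_coef (hecke_row k d 'X_i F) u m' != 0)%R ->
    mdeg m' + (n.+1 - (k + d)) + \sum_(p < n.+1 | k <= p) lis w p <=
    B.+1 + \sum_(p < n.+1 | k <= p) (n.+1 - p).
  apply: (IH u w q) => //; rewrite ?sumE ?sumEq; try lia.
  - move=> p /ge_cases[->|wp]; last by have := all_le p wp; lia.
    by case: q_cases => [e|[r [_ wr e]]]; last have := all_le r wr; lia.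
  - move=> p /ge_cases[->|wp]; first by rewrite ltnn.
    by have := all_le p wp; lia.
  - by case: q_cases => [e|[r [_ wr e]]]; last have := all_le r wr; lia.
have kdn : k + d < n by lia.
move=> /(signed_coef_neq0_hecke kdn) [/unused|[desc [m' ->]]]; first lia.
move: (desc); rewrite (left_descentE kdn uc uq) => cq.
rewrite mdegD mdeg1.
case=> [coef|].
  (* Used without sorting: the position moves right to q in the same block. *)
  have := IH u w q B; rewrite !sumE !sumEq => /(_ _ _ _ _ _ _ _ _ m' coef) {}IH.
  suff : mdeg m' + (n.+1 - (k + d)) + \sum_(p < n.+1 | k <= p) lis w p <=
    B + \sum_(p < n.+1 | k <= p) (n.+1 - p) by lia.
  apply: IH => //; try lia.
  - move=> p /ge_cases[->|wp]; last by have := all_le p wp; lia.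
    case: q_cases => [e|[r [qr wr e]]]; first lia.
    by have := right_le r wr (ltn_trans cq qr); lia.
  - move=> p /ge_cases[->|wp]; first by rewrite ltnn.
    by move=> qp; have := right_le p wp (ltn_trans cq qp); lia.
  - case: q_cases => [e|[r [qr wr e]]]; first lia.
    by have := right_le r wr (ltn_trans cq qr); lia.
(* Used with sorting: the position stays at c, where the chain length grows past
   that of q; this growth pays for the chains that start at q. *)
set u' := swap_letter _ u => coef.
have mono' p : lis u p <= lis u' p by apply: lis_swap_letter.
have u'c : u' c = k + d :> nat.
  by rewrite /u' swap_letter_val // uc eqxx ifF //; lia.
have u'q : u' q = (k + d).+1 :> nat by rewrite /u' swap_letter_val // uq eqxx.
have c_grows : lis u' q < lis u' c by apply: lis_step; rewrite // u'c u'q.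
have sum_c : \sum_(r | k + d < w r) lis u' r =
    lis u' c + \sum_(r | (k + d < w r) && (r != c)) lis u' r.
  by rewrite (bigD1 c) //; have := agree c; rewrite uc; lia.
have sum_mono : \sum_(r | k + d < w r) lis u r <= \sum_(r | k + d < w r) lis u' r.
  exact: leq_sum.
have sum_mono_c : \sum_(r | (k + d < w r) && (r != c)) lis u r <=
    \sum_(r | (k + d < w r) && (r != c)) lis u' r by apply: leq_sum.
have mono'_q := mono' q.
have := IH u' w c B; rewrite !sumE !sumEc => /(_ _ _ _ _ _ _ _ _ m' coef) {}IH.
suff : mdeg m' + (n.+1 - (k + d)) + \sum_(p < n.+1 | k <= p) lis w p <=
  B + \sum_(p < n.+1 | k <= p) (n.+1 - p) by lia.
apply: IH => //; try lia.
- move=> p; rewrite -agree' /u' swap_letter_val //.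
  by case: eqP => [->|_]; [lia | case: eqP => [->|//]; lia].
- by move=> p; apply: leq_trans (mono p) (mono' p).
- by move=> p /ge_cases[->|wp]; last have := all_le p wp; lia.
- by move=> p /ge_cases[->|wp] cp; last have := right_le p wp cp; lia.
Qed.
End RowDegree.

(** * Degree of a row: the bound is attained *)

Section RowDegreeAttained.
Variable n : nat.
Implicit Types (u v w : 'S_n.+1) (c p q r i : 'I_n.+1) (m : 'X_{1..n.+1}).
Local Notation R := {mpoly int[n.+1]}.
Implicit Types (F : 'S_n.+1 -> R).

(** The choices that attain the bound.  Above the value w z, a letter is left out
    when the next value has a larger chain length than the current position c,
    used without sorting when it has the same, and used with sorting when it has
    a smaller one; no chain length changes, and B is the largest chain length met
    so far.  The letter that reaches w z is left out, and all the letters below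
    are used with sorting, which brings the value k to the position z and leaves
    the chain lengths to the right of z unchanged. *)
Lemma row_degree_ge k i F w (z : 'I_n.+1) : z = k :> nat -> fixes_below k w ->
  (forall u m, (0 <= signed_coef F u m)%R) ->
  (forall u, fixes_below k.+1 u -> exists2 m, (0 < signed_coef F u m)%R &
     mdeg m + \sum_(p < n.+1 | k < p) lis u p = \sum_(p < n.+1 | k < p) (n.+1 - p)) ->
  forall d u c B, k + d <= n ->
  (forall p, minn (u p) (k + d) = minn (w p) (k + d)) ->
  u c = k + d :> nat ->
  [/\ w z < k + d, B = lis w c, forall p, k + d <= w p -> lis w p <= B
    & forall p, lis u p = lis w p] \/
  [/\ k + d <= w z, c = z, B = lis w z & forall p, z < p -> lis u p = lis w p] ->
  exists2 m, (0 < signed_coef (hecke_row k d 'X_i F) u m)%R &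
  mdeg m + (n.+1 - (k + d)) + \sum_(p < n.+1 | k <= p) lis w p =
  B + \sum_(p < n.+1 | k <= p) (n.+1 - p).
Proof.
move=> zk /fixes_belowP fix_w F_ge0 F_top.
have z_min p : k <= w p -> z <= p.
  by rewrite zk; have [lt|//] := ltnP p k; rewrite fix_w // leqNgt lt.
have z_ge : k <= w z.
  have [lt|//] := ltnP (w z) k.
  by have /(congr1 val)/position_inj/(congr1 val) /= := fix_w _ lt; lia.
elim=> [|d IH] u c B kd agree uc phase.
  rewrite addn0 in agree uc phase *.
  case: phase => [[]|[_ cz BE lis_eq]]; first by rewrite ltnNge z_ge.
  have fix_u : fixes_below k.+1 u.
    apply/fixes_belowP => p pk; apply: val_inj => /=.
    have [lt|ge] := ltnP p k.
      by have := agree p; rewrite (fix_w _ lt); lia.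
    have -> : p = c by apply: val_inj; rewrite cz /= zk; lia.
    by rewrite uc cz.
  have [m coef deg] := F_top u fix_u; exists m; first by [].
  have tail (f : 'I_n.+1 -> nat) : \sum_(p < n.+1 | k <= p) f p =
      f z + \sum_(p < n.+1 | k < p) f p.
    rewrite (bigD1 z) /= ?zk //; congr (_ + _).
    by apply: eq_bigl => p; rewrite -val_eqE /= zk; lia.
  have e : \sum_(p < n.+1 | k < p) lis u p = \sum_(p < n.+1 | k < p) lis w p.
    by apply: eq_bigr => p kp; apply: lis_eq; rewrite zk.
  move: deg; rewrite !tail e BE zk.
  by move: (bigop _ _ _) (bigop _ _ _); lia.
rewrite addnS in kd agree uc phase *.
have kdn : k + d < n by lia.
have [q wq] := exists_position w (ltnW kd).
have uq : u q = k + d :> nat by have := agree q; rewrite wq; lia.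
have qc : q != c by apply/eqP => e; move: uc; rewrite -e uq; lia.
have wc : k + d < w c by have := agree c; rewrite uc; lia.
have agree' p : minn (u p) (k + d) = minn (w p) (k + d) by have := agree p; lia.
have ge_cases p : k + d <= w p -> p = q \/ k + d < w p.
  rewrite leq_eqVlt => /orP[/eqP|]; last by right.
  by rewrite -wq => /position_inj ->; left.
have row_ge0 v m : (0 <= signed_coef (hecke_row k d 'X_i F) v m)%R.
  by apply: signed_coef_ge0_row => //; lia.
have descE := left_descentE kdn uc uq.
have unused : (exists2 m, (0 < signed_coef (hecke_row k d 'X_i F) u m)%R &
    mdeg m + (n.+1 - (k + d)) + \sum_(p < n.+1 | k <= p) lis w p =
    B.+1 + \sum_(p < n.+1 | k <= p) (n.+1 - p)) ->
  exists2 m, (0 < signed_coef (hecke_row k d.+1 'X_i F) u m)%R &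
    mdeg m + (n.+1 - (k + d).+1) + \sum_(p < n.+1 | k <= p) lis w p =
    B + \sum_(p < n.+1 | k <= p) (n.+1 - p).
  move=> [m coef deg]; exists m; first exact: signed_coef_gt0_unused.
  by move: deg; move: (bigop _ _ _) (bigop _ _ _); lia.
have used v : v = u \/ v = swap_letter (k + d) u -> c < q ->
  (exists2 m, (0 < signed_coef (hecke_row k d 'X_i F) v m)%R &
    mdeg m + (n.+1 - (k + d)) + \sum_(p < n.+1 | k <= p) lis w p =
    B + \sum_(p < n.+1 | k <= p) (n.+1 - p)) ->
  exists2 m, (0 < signed_coef (hecke_row k d.+1 'X_i F) u m)%R &
    mdeg m + (n.+1 - (k + d).+1) + \sum_(p < n.+1 | k <= p) lis w p =
    B + \sum_(p < n.+1 | k <= p) (n.+1 - p).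
  move=> vE cq [m coef deg]; exists (U_(i) + m)%MM.
    by apply: signed_coef_gt0_used => //; [rewrite descE | case: vE => <-; [left|right]].
  by rewrite mdegD mdeg1; move: deg; move: (bigop _ _ _) (bigop _ _ _); lia.
have agree_swap p : minn (swap_letter (k + d) u p) (k + d) = minn (w p) (k + d).
  rewrite -agree' swap_letter_val //.
  by case: eqP => [->|_]; [lia | case: eqP => [->|//]; lia].
have swap_c : swap_letter (k + d) u c = k + d :> nat.
  by rewrite swap_letter_val // uc eqxx ifF //; lia.
have lis_q_le M : (forall p, k + d < w p -> lis w p <= M) -> lis w q <= M.+1.
  move=> le; case: (lis_cases w q) => [->//|[r [_ wqr ->]]].
  by rewrite ltnS le // -wq.
have lis_q_gt : q < c -> lis w c < lis w q by move=> lt; apply: lis_step; rewrite // wq.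
have q_c : q < c \/ c < q by move: qc; rewrite -val_eqE /=; lia.
case: phase => [[wz BE max_B lis_eq]|[wz cz BE lis_eq]]; last first.
  have cq : c < q.
    by case: q_c => // lt; have := z_min q; rewrite wq cz in lt *; lia.
  apply: (used (swap_letter (k + d) u)) => //; first by right.
  apply: (IH _ c) => //; first lia.
  right; split=> //; first exact: ltnW.
  move=> p zp; rewrite -lis_eq //; apply: (lis_swap_letter_right (c := c)) => //.
    by rewrite descE.
  by rewrite cz.
have lis_q := lis_q_le B max_B.
have [qz|nqz] := eqVneq q z.
  have zc : q < c.
    by case: q_c => // lt; have := z_min c; rewrite -qz; lia.
  apply: unused; apply: (IH u z) => //; try lia; first by rewrite -qz.
  right; split=> //; first by rewrite -qz wq.
  by rewrite -qz; have := lis_q_gt zc; lia.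
have wz' : w z < k + d.
  rewrite ltn_neqAle -ltnS wz andbT.
  by apply: contra nqz => /eqP; rewrite -wq => /position_inj ->.
have [high|] := ltnP B (lis w q).
  apply: unused; apply: (IH u q) => //; first lia.
  left; split=> //; first lia.
  by move=> p /ge_cases[->//|/max_B/leq_trans]; apply.
move=> low; have cq : c < q by case: q_c => // /lis_q_gt; lia.
move: low; rewrite leq_eqVlt => /orP[/eqP same|low].
  apply: (used u) => //; first by left.
  apply: (IH u q) => //; first lia.
  left; split=> // p /ge_cases[->|/max_B //]; lia.
apply: (used (swap_letter (k + d) u)) => //; first by right.
apply: (IH _ c) => //; first lia.
left; split=> //.
  by move=> p /ge_cases[->|/max_B //]; lia.
move=> p; rewrite -lis_eq; apply: (lis_swap_letter_eq _ kdn uc uq cq).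
by rewrite !lis_eq -BE.
Qed.
End RowDegreeAttained.

(** * Degree of Grothendieck polynomials *)

Section Degree.
Variable n : nat.
Implicit Types (u w : 'S_n.+1) (p c : 'I_n.+1) (m : 'X_{1..n.+1}).

Lemma lis_max_value w c : w c = n :> nat -> lis w c = 1.
Proof.
move=> wc; case: (lis_cases w c) => // -[r [_ + _]].
by rewrite wc ltnNge -ltnS ltn_ord.
Qed.

Lemma max_value_unique w c p : w c = n :> nat -> n <= w p -> p = c.
Proof. by move=> wc le; apply: (@position_inj _ w); have := ltn_ord (w p); lia. Qed.

Lemma last_rows_degree_le d u m : d <= n.+1 ->
  (signed_coef (last_rows d) u m != 0)%R ->
  mdeg m + \sum_(p < n.+1 | n.+1 - d <= p) lis u p <=
  \sum_(p < n.+1 | n.+1 - d <= p) (n.+1 - p).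
Proof.
elim: d u m => [|d IH] w m dn.
  rewrite /signed_coef mulf_eq0 negb_or => /andP[_] /=.
  case: (w == 1%g); last by rewrite mulr0n mcoeff0 eqxx.
  rewrite mulr1n mcoeff1; have [-> _|_] := eqVneq m 0%MM; last by rewrite eqxx.
  by rewrite mdeg0 !big1 // => p; have := ltn_ord p; lia.
have kd : n - d + d = n by lia.
have [c wc] := exists_position w (leqnn n).
have sumE (f : 'I_n.+1 -> nat) : \sum_(r | n <= w r) f r = f c.
  rewrite (big_pred1 c) // => r; apply/idP/eqP => [|->]; last by rewrite wc.
  exact: max_value_unique.
have := @row_degree_le n (n - d) (inord (n - d)) (last_rows d) _ d w w c 1.
rewrite kd !sumE (lis_max_value wc) => H nz.
have := H _ (leqnn n) _ wc _ _ _ _ _ m nz; rewrite subSn // subnn.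
move=> {}H; have := H _ _ _ _ _ _ _; rewrite subSS => {}H.
suff : mdeg m + 1 + \sum_(p < n.+1 | n - d <= p) lis w p <=
    1 + \sum_(p < n.+1 | n - d <= p) (n.+1 - p).
  by move: (bigop _ _ _) (bigop _ _ _); lia.
apply: H => //.
- move=> u {}m {}nz; have e : (n - d).+1 = n.+1 - d by lia.
  rewrite e; split; last by apply: IH; rewrite // ltnW.
  apply: contraNT nz => no; rewrite /signed_coef (@last_rows_supported n d) //; try lia.
  by rewrite mcoeff0 mulr0.
- by move=> p /(max_value_unique wc) ->; rewrite (lis_max_value wc).
- by move=> p /(max_value_unique wc) ->; rewrite ltnn.
Qed.

Lemma signed_coef_last_rows_ge0 d u m : d <= n.+1 ->
  (0 <= signed_coef (last_rows d) u m)%R.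
Proof.
elim: d u m => [|d IH] u m dn.
  rewrite /signed_coef /=; case: eqP => [->|_]; last by rewrite mcoeff0 mulr0.
  rewrite mulr1n mcoeff1; have [->|_] := eqVneq m 0%MM; last by rewrite mulr0.
  rewrite mdeg0 (_ : num_inv _ = 0) //.
  apply: eq_card0 => -[a b]; rewrite !inE !perm1; lia.
by apply: signed_coef_ge0_row => [|v m']; [lia | apply: IH; lia].
Qed.

Lemma last_rows_degree_ge d u : d <= n.+1 -> fixes_below (n.+1 - d) u ->
  exists2 m, (0 < signed_coef (last_rows d) u m)%R &
  mdeg m + \sum_(p < n.+1 | n.+1 - d <= p) lis u p =
  \sum_(p < n.+1 | n.+1 - d <= p) (n.+1 - p).
Proof.
elim: d u => [|d IH] w dn fix_w.
  exists 0%MM; last by rewrite mdeg0 !big1 // => p; have := ltn_ord p; lia.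
  have -> : w = 1%g.
    by apply/permP => p; rewrite perm1; apply: (fixes_belowP _ _ fix_w); rewrite subn0.
  by rewrite lt_def signed_coef_last_rows_ge0 // andbT /signed_coef /= eqxx
    mcoeff1 eqxx mulr1 signr_eq0.
have kd : n - d + d = n by lia.
have [c wc] := exists_position w (leqnn n).
have zE : (inord (n - d) : 'I_n.+1) = n - d :> nat by rewrite inordK //; lia.
have := @row_degree_ge n (n - d) (inord (n - d)) (last_rows d) w _ zE.
rewrite subSS in fix_w * => /(_ fix_w (fun u m => signed_coef_last_rows_ge0 u m (ltnW dn))).
have -> : (n - d).+1 = n.+1 - d by lia.
move=> /(_ (fun u => IH u (ltnW dn)) d w c 1).
rewrite kd => /(_ (leqnn n) (fun=> erefl) wc) [|m coef].
  have [wz|wz] := ltnP (w (inord (n - d))) n; [left | right].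
    split=> //; first by rewrite (lis_max_value wc).
    by move=> p /(max_value_unique wc) ->; rewrite (lis_max_value wc).
  have zc := max_value_unique wc wz.
  by split=> //; rewrite zc (lis_max_value wc).
move=> deg; exists m => //; move: deg; rewrite subSn // subnn.
by move: (bigop _ _ _) (bigop _ _ _); lia.
Qed.

Lemma msize_grothendieck w : msize (grothendieck w) = (raj w).+1.
Proof.
rewrite grothendieck_rows.
have total (f : 'I_n.+1 -> nat) : \sum_(p < n.+1 | n.+1 - n.+1 <= p) f p = \sum_p f p.
  by apply: eq_bigl => p; rewrite subnn.
have fix0 : fixes_below (n.+1 - n.+1) w.
  by apply/fixes_belowP => p; rewrite subnn.
have [m coef] := last_rows_degree_ge (leqnn _) fix0; rewrite !total -(raj_lis w).
move=> /addIn deg.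
apply/eqP; rewrite eqn_leq; apply/andP; split.
  rewrite msizeE; apply/bigmax_leqP_seq => m' m'_in _; rewrite ltnS.
  have := @last_rows_degree_le n.+1 w m' (leqnn _); rewrite !total -(raj_lis w) leq_add2r.
  by apply; rewrite /signed_coef mulf_eq0 signr_eq0 -mcoeff_msupp.
rewrite -deg; apply: msize_mdeg_lt; rewrite mcoeff_msupp.
by apply: contraTneq coef => z; rewrite /signed_coef z mulr0 ltxx.
Qed.

End Degree.

(** * The theorem *)

Lemma msize_top_part n (p : {mpoly int[n]}) : msize (top_part p) = msize p.
Proof.
have [->|nz] := eqVneq p 0%R; first by rewrite /top_part pihomog0.
have coefE m : mdeg m = mpoly_deg p -> ((top_part p)@_m = p@_m)%R.
  move=> deg; rewrite /top_part pihomogE raddf_sum /= big_mkcond /=.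
  rewrite (eq_bigr (fun m' => if m' == m then p@_m else 0)%R) => [|m' _].
    rewrite -big_mkcond /=; have [m_in|m_out] := boolP (m \in msupp p).
      by rewrite -big_filter filter_pred1_uniq ?msupp_uniq // big_seq1.
    by rewrite big1 ?memN_msupp_eq0 // => m' _; rewrite memN_msupp_eq0.
  rewrite mcoeffZ mcoeffX; have [->|_] := eqVneq m' m; last by rewrite mulr0 if_same.
  by rewrite deg eqxx mulr1.
apply/eqP; rewrite eqn_leq; apply/andP; split.
  rewrite msizeE; apply/bigmax_leqP_seq => m m_in _.
  have /dhomogP/(_ m m_in) /= -> : top_part p \is (mpoly_deg p).-homog by apply: pihomogP.
  by rewrite /mpoly_deg prednK // lt0n msize_poly_eq0.
have deg : mdeg (mlead p) = mpoly_deg p by rewrite /mpoly_deg -mlead_deg.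
rewrite -(mlead_deg nz); apply: msize_mdeg_lt.
by rewrite mcoeff_msupp coefE // mleadc_eq0.
Qed.

Lemma deg_castelnuovo_mumford n (w : 'S_n) : mpoly_deg (castelnuovo_mumford w) = raj w.
Proof.
rewrite /castelnuovo_mumford /mpoly_deg msize_top_part msizeZ; last first.
  by rewrite expfz_neq0 // oppr_eq0 oner_eq0.
case: n w => [|n] w; last by rewrite msize_grothendieck.
rewrite /raj big_ord0; apply/eqP; rewrite -leqn0 -subn1 leq_subLR addn0 msizeE.
apply/bigmax_leqP_seq => m _ _; by rewrite mdegE big_ord0.
Qed.

Theorem theorem1p5 (n : nat) (w : 'S_n) :
  [/\ raj w = (\max_(v : 'S_n | leR v w) maj v)%N,
      (\max_(v : 'S_n | leR v w) maj v)%N =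
        (\max_(u : 'S_n | leL u w) maj (u^-1)%g)%N
    & (\max_(u : 'S_n | leL u w) maj (u^-1)%g)%N =
        mpoly_deg (castelnuovo_mumford w)].
Proof. by rewrite max_maj_leR max_maj_leL deg_castelnuovo_mumford. Qed.
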